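(* Let $l\ge 1$, let $\lambda=(1^l)=(1,\ldots,1)$ ($l$ ones), and write $\mathcal{A}_n$ for the intrinsic hyperplane arrangement of the irreducible $\mathfrak{S}_n$-representation attached to $\lambda[n]=(n-l,1^l)$. Then there exists a function $f_l:\mathbb{N}\to\mathbb{N}$ such that for all $n\ge 0$, $f_l(n)$ is a lower bound on the first Kazhdan–Lusztig coefficient of $\mathcal{A}_n$ (the coefficient of $t$ in the Kazhdan–Lusztig polynomial $p_{\mathcal{A}_n}(t)$), and $$\lim_{n\to\infty}\frac{f_l(n)\,(l+1)!}{(l+1)^n}=1.$$
   Context: Representations. $[n]=\{1,\dots,n\}$. For a partition $\mu$ of $n$, $S^\mu$ is the complex irreducible representation (Specht module) of the symmetric group $\mathfrak{S}_n$ attached to $\mu$, with $S^{(n)}$ trivial. For $n\ge l+1$ put $S^\lambda_n:=S^{(n-l,1^l)}$ (this is $\bigwedge^l$ of the standard representation $S^{(n-1,1)}$); for $n<l+1$ one sets $S^\lambda_n=0$, with the empty arrangement. Intrinsic arrangement. Let $\mu$ be a partition of $n$ and $\mu^\dagger$ its conjugate (transposed) partition. Let $\mathbb{P}_n(\mu^\dagger)$ be the set of set partitions $\alpha$ of $[n]$ whose block sizes are the parts of $\mu^\dagger$. For $\alpha=\{\alpha_1,\alpha_2,\dots\}\in\mathbb{P}_n(\mu^\dagger)$ let $\mathfrak{S}_\alpha=\prod_j\mathfrak{S}_{\alpha_j}\subseteq\mathfrak{S}_n$ and let $T_\alpha$ be a set of transpositions generating $\mathfrak{S}_\alpha$. Put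 $H_\alpha:=\sum_{\tau\in T_\alpha}(S^\mu)^\tau$, where $(S^\mu)^\tau$ is the subspace fixed by $\tau$. It is known (Tsilevich–Vershik–Yuzvinsky) that $H_\alpha$ is a hyperplane in $S^\mu$ independent of the choice of $T_\alpha$. The intrinsic hyperplane arrangement of $S^\mu$ is $\{H_\alpha\mid\alpha\in\mathbb{P}_n(\mu^\dagger)\}$. For $\mu=(n-l,1^l)$ the index set is in bijection with subsets of $[n]$ of size $l+1$ (the non-singleton block). Kazhdan–Lusztig polynomial. Let $\mathcal{A}$ be a finite central hyperplane arrangement in a complex vector space $V$; choose for each $H\in\mathcal{A}$ a normal vector $a(H)$. The complement $\mathcal{M}(\mathcal{A})=\{v\in V\mid\langle v,a(H)\rangle\ne 0\ \forall H\in\mathcal{A}\}$ is embedded in the torus $(\mathbb{C}^\times)^{\mathcal{A}}$ via the coordinates $\langle a(H),\cdot\rangle$. Let $\mathcal{M}^{-1}(\mathcal{A})$ be the image of $\mathcal{M}(\mathcal{A})$ under inversion of every coordinate of the torus; the reciprocal plane $X_{\mathcal{A}}$ is the closure of $\mathcal{M}^{-1}(\mathcal{A})$ in $\mathbb{C}^{\mathcal{A}}$. The Kazhdan–Lusztig polynomial $p_{\mathcal{A}}(t)$ is the polynomial whose coefficient of $t^i$ is $\dim_{\mathbb{C}}IH^{2i}(X_{\mathcal{A}};\mathbb{C})$ (intersection cohomology). Equivalently (Elias–Proudfoot–Wakefield), $p_{\mathcal{A}}$ is the Kazhdan–Lusztig polynomial of the matroid of $\mathcal{A}$, defined recursively from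 its lattice of flats: $P_M(t)=1$ if $\operatorname{rk}M=0$; $\deg P_M<\tfrac12\operatorname{rk}M$ if $\operatorname{rk}M>0$; and $t^{\operatorname{rk}M}P_M(t^{-1})=\sum_F\chi_{M_F}(t)P_{M^F}(t)$, the sum being over flats $F$, where $M_F$ is the matroid with lattice of flats the interval $[\hat 0,F]$, $M^F$ the one with lattice of flats $[F,\hat 1]$, and $\chi$ the characteristic polynomial. *)

(* Defs.v *)
From HB Require Import structures.
From mathcomp Require Import all_boot all_order all_algebra all_fingroup.
From mathcomp Require classical_sets.

Set Implicit Arguments.
Unset Strict Implicit.
Unset Printing Implicit Defensive.

Import GRing.Theory.
Local Open Scope ring_scope.

(* Matroids are given by their rank function [rk] on a finite ground set [E]. *)
Section KazhdanLusztig.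
Variables (E : finType) (rk : {set E} -> nat).

Definition flat (F : {set E}) : bool :=
  [forall x, (x \notin F) ==> (rk F < rk (x |: F))%N].

Definition cl (A : {set E}) : {set E} := [set x | rk (x |: A) == rk A].

(* Moebius function of the lattice of flats.  The fuel [#|E|] used in [mobius]
   bounds the length of every chain of flats. *)
Fixpoint mobius_rec (n : nat) (G F : {set E}) : int :=
  if G == F then 1 else
  if n is m.+1 then
    - \sum_(K : {set E} | [&& flat K, G \subset K & K \proper F])
        mobius_rec m G K
  else 0.

Definition mobius (G F : {set E}) : int := mobius_rec #|E| G F.

(* For flats G \subset F: the characteristic polynomial of the matroid whose
   lattice of flats is the interval [G, F]. *)
Definition char_poly_int (G F : {set E}) : {poly int} :=
  \sum_(K : {set E} | [&& flat K, G \subset K & K \subset F])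
    mobius G K *: 'X^(rk F - rk K).

(* t^r p(t^-1), for p of degree at most r *)
Definition revpoly (r : nat) (p : {poly int}) : {poly int} :=
  \poly_(i < r.+1) p`_(r - i).

(* For a flat G, [P G] plays the role of the Kazhdan-Lusztig polynomial of M^G,
   the matroid of rank rk E - rk G with lattice of flats [G, E].  This family is
   closed under the recursion: for flats G \subset F, the matroid (M^G)_F has
   lattice of flats [G, F], and (M^G)^F = M^F. *)
Definition KL_family (P : {set E} -> {poly int}) : Prop :=
  forall G : {set E}, flat G ->
  let r := (rk [set: E] - rk G)%N in
  [/\ r = 0%N -> P G = 1,
      (0 < r)%N -> ((size (P G)).-1.*2 < r)%N
    & revpoly r (P G) =
      \sum_(F : {set E} | flat F && (G \subset F)) char_poly_int G F * P F].

(* [cl set0] is the least flat, so that M^(cl set0) has the lattice of flats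
   of M itself. *)
Definition is_KL_poly (p : {poly int}) : Prop :=
  exists2 P, KL_family P & p = P (cl set0).

(* By Elias-Proudfoot-Wakefield, exactly one polynomial satisfies [is_KL_poly]
   when rk is the rank function of a matroid. *)
Definition KL_poly : {poly int} := classical_sets.xget 0 is_KL_poly.

End KazhdanLusztig.

(* A finite central arrangement in the subspace [arr_space] of V; the
   hyperplanes are vector subspaces of [arr_space]. *)
Record arrangement (K : fieldType) (V : vectType K) := Arrangement {
  arr_space : {vspace V};
  arr_hyps : seq {vspace V}
}.

Definition arr_ground (K : fieldType) (V : vectType K) (A : arrangement V) :
  finType := seq_sub (arr_hyps A).

(* The rank of a set of hyperplanes is the codimension of its intersection. *)
Definition arr_rank (K : fieldType) (V : vectType K) (A : arrangement V)
    (B : {set arr_ground A}) : nat :=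
  (\dim (arr_space A)
   - \dim (arr_space A :&: \bigcap_(H in B) ssval H)%VS)%N.

Definition arr_KL_poly (K : fieldType) (V : vectType K) (A : arrangement V) :
  {poly int} := KL_poly (@arr_rank K V A).

Section Specht.
Variables (K : fieldType) (n : nat).

(* A tabloid of shape mu |- n is encoded by the word sending each x in 'I_n to
   the index of its row; 'I_n is large enough for the indices of rows and
   columns.  The permutation module on tabloids of any shape is a subspace of
   the space [word_space] of functions on words. *)
Definition word := {ffun 'I_n -> 'I_n}.
Definition word_space := {ffun word -> K^o}.

Definition delta_word (w0 : word) : word_space :=
  [ffun w => (w == w0)%:R].

(* The left action sending [delta_word w] to [delta_word (w \o s^-1)]. *)
Definition word_act (s : 'S_n) (f : word_space) : word_space :=
  [ffun w : word => f [ffun x => w (s x)]].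

Fact word_act_is_linear s : linear (word_act s).
Proof. by move=> a f g; apply/ffunP=> w; rewrite !ffunE. Qed.

HB.instance Definition _ s :=
  GRing.isLinear.Build K word_space word_space _ (word_act s)
    (word_act_is_linear s).

(* Partitions are nonincreasing sequences of positive integers. A tableau sends
   each x in 'I_n to its cell (row, column), with rows and columns numbered from
   0.  When sumn mu = n, an injection into the diagram is a bijection. *)
Definition is_tableau (mu : seq nat) (t : {ffun 'I_n -> 'I_n * 'I_n}) : bool :=
  injectiveb t && [forall x, ((t x).2 < nth 0 mu (t x).1)%N].

Definition column_stab (t : {ffun 'I_n -> 'I_n * 'I_n}) : pred 'S_n :=
  [pred s : 'S_n | [forall x, (t (s x)).2 == (t x).2]].

Definition polytabloid (t : {ffun 'I_n -> 'I_n * 'I_n}) : word_space :=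
  \sum_(s : 'S_n | column_stab t s)
    (-1) ^+ s *: word_act s (delta_word [ffun x => (t x).1]).

Definition specht (mu : seq nat) : {vspace word_space} :=
  <<[seq polytabloid t | t in is_tableau mu]>>%VS.

Definition conj_part (mu : seq nat) : seq nat :=
  [seq count (fun m => j < m)%N mu | j <- iota 0 (head 0%N mu)].

Definition set_partitions_of_type (nu : seq nat) : {set {set {set 'I_n}}} :=
  [set alpha : {set {set 'I_n}} |
    partition alpha [set: 'I_n] &&
    perm_eq (map (fun B : {set 'I_n} => #|B|) (enum alpha)) nu].

(* T_alpha is taken to be the set of all transpositions in S_alpha. *)
Definition intrinsic_hyp (mu : seq nat) (alpha : {set {set 'I_n}}) :
    {vspace word_space} :=
  (\sum_(ij : 'I_n * 'I_n |
         (ij.1 != ij.2) && [exists B in alpha, (ij.1 \in B) && (ij.2 \in B)])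
    (specht mu :&: fixedSpace (linfun (word_act (tperm ij.1 ij.2)))))%VS.

Definition intrinsic_arr (mu : seq nat) : arrangement word_space :=
  Arrangement (specht mu)
    [seq intrinsic_hyp mu alpha
       | alpha <- enum (set_partitions_of_type (conj_part mu))].

End Specht.

(* The partition (n - l, 1^l) of n, for l < n. *)
Definition hook (l n : nat) : seq nat := (n - l)%N :: nseq l 1%N.

(* The representation is zero, with the empty arrangement, for n < l + 1. *)
Definition hook_arr (K : fieldType) (l n : nat) :
    arrangement (word_space K n) :=
  if (l < n)%N then intrinsic_arr K n (hook l n)
  else Arrangement 0%VS [::].

(* Main.v *)
Require Import Defs.
From HB Require Import structures.
From mathcomp Require Import all_boot all_order all_algebra all_fingroup.
From mathcomp Require Import zify ring lra.

(** Comparing coefficients of degree [rk M - 1] in the defining recursion shows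
    that the first Kazhdan-Lusztig coefficient of a matroid is the number of its
    coatoms minus the number of its atoms; the polynomial exists because the
    characteristic polynomial is a kernel in Stanley's sense.

    On the representation of shape (n-l, 1^l), the hyperplane of an
    (l+1)-subset A of [n] is the kernel of the antisymmetrizer of the symmetric
    group of A.  A surjective coloring c of [n] by l+1 colors yields a coatom,
    formed by the hyperplanes of the sets A that are not rainbow: it is cut out by
    a vector psi, a sum of polytabloids whose columns are rainbow.  The symmetry of
    psi puts it in the hyperplanes of the non-rainbow sets, positivity keeps it out
    of the others, and Garnir-like exchange relations show that nothing
    else but the common kernel is cut out.  Colorings with different kernels yield
    different coatoms, so there are at least S(n, l+1) ~ (l+1)^n / (l+1)! of them,
    while there are at most binomial(n, l+1) atoms. *)

Set Implicit Arguments.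
Unset Strict Implicit.
Unset Printing Implicit Defensive.

Import Order.TTheory GRing.Theory Num.Theory.
Local Open Scope ring_scope.

(** * First Kazhdan-Lusztig coefficient *)

Section Revpoly.

Lemma coef_revpoly r p i : (revpoly r p)`_i = if (i <= r)%N then p`_(r - i) else 0.
Proof. by rewrite coef_poly ltnS. Qed.

Lemma revpoly_is_linear r : linear (revpoly r).
Proof.
move=> a p q; apply/polyP=> i; rewrite coefD coefZ !coef_revpoly coefD coefZ.
by case: ifP => // _; rewrite mulr0 addr0.
Qed.

HB.instance Definition _ r :=
  GRing.isLinear.Build int {poly int} {poly int} _ (revpoly r)
    (revpoly_is_linear r).

Lemma revpolyXn r i : (i <= r)%N -> revpoly r 'X^i = 'X^(r - i).
Proof.
move=> le_ir; apply/polyP=> j; rewrite coef_revpoly !coefXn.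
case: leqP => [le_jr|lt_rj]; last by rewrite gtn_eqF // (leq_ltn_trans (leq_subr _ _)).
by congr (_%:R); apply/eqP/eqP; lia.
Qed.

(** Both sides are bilinear, so the identity reduces to monomials; the size bounds make [a] and [b]
    legitimate formal degrees. *)
Lemma revpolyM a b (p q : {poly int}) : (size p <= a.+1)%N -> (size q <= b.+1)%N ->
  revpoly (a + b) (p * q) = revpoly a p * revpoly b q.
Proof.
move=> sp sq.
have E c (u : {poly int}) : (size u <= c.+1)%N -> u = \sum_(i < c.+1) u`_i *: 'X^i.
  by move=> su; rewrite -poly_def; apply/polyP=> i; rewrite coef_poly;
     case: ltnP => // lt_ci; rewrite nth_default // (leq_trans su).
rewrite [in LHS](E a p sp) [in LHS](E b q sq) [in RHS](E a p sp) [in RHS](E b q sq).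
rewrite mulr_suml !linear_sum mulr_suml /=; apply: eq_bigr => i _.
rewrite mulr_sumr !linear_sum linearZ /= mulr_sumr; apply: eq_bigr => j _.
have [le_ia le_jb] := (ltn_ord i, ltn_ord j); rewrite !ltnS in le_ia le_jb.
rewrite -scalerAl -scalerAr -exprD !linearZ /= -scalerAl -scalerAr.
by rewrite !revpolyXn ?leq_add // -exprD; congr (_ *: (_ *: 'X^_)); lia.
Qed.

End Revpoly.

(** * Existence of Kazhdan-Lusztig polynomials over a lattice of flats *)

Section KLPolynomials.

Variables (E : finType) (rk : {set E} -> nat).
Hypothesis rk_mono : forall A B : {set E}, A \subset B -> (rk A <= rk B)%N.

Local Notation flat := (flat rk).
Local Notation mobius := (mobius rk).
Local Notation chi := (char_poly_int rk).

Lemma flatT : flat [set: E].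
Proof. by apply/forallP=> x; rewrite inE. Qed.

Lemma rk_flat_proper (G F : {set E}) : flat G -> G \proper F -> (rk G < rk F)%N.
Proof.
move=> /forallP fG /properP[sGF [x xF xG]].
apply: leq_trans (implyP (fG x) xG) _.
by apply: rk_mono; rewrite subUset sub1set xF.
Qed.

(** Each recursive call strictly shrinks [F :\: G], so every fuel at least its cardinality yields
    the same value. *)
Lemma mobius_rec_fuel n m (G F : {set E}) : G \subset F ->
  (#|F :\: G| <= n)%N -> (#|F :\: G| <= m)%N ->
  mobius_rec rk n G F = mobius_rec rk m G F.
Proof.
elim: n m F => [|n IHn] [|m] F sGF //=.
- rewrite leqn0 cards_eq0 setD_eq0 => sFG _.
  by have -> : G == F by rewrite eqEsubset sGF.
- move=> _; rewrite leqn0 cards_eq0 setD_eq0 => sFG.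
  by have -> : G == F by rewrite eqEsubset sGF.
case: eqP => // _ leFn leFm; congr (- _).
apply: eq_bigr => K /and3P[_ sGK pKF].
have ltK : (#|K :\: G| < #|F :\: G|)%N.
  apply: proper_card; apply/properP; split; first exact: setSD (proper_sub pKF).
  have /properP[_ [x xF xK]] := pKF; exists x; last by rewrite inE (negPf xK) andbF.
  by rewrite inE xF andbT; apply: contra xK => /(subsetP sGK).
by apply: IHn => //; rewrite -ltnS; apply: leq_trans ltK _.
Qed.

Lemma mobiusGG (G : {set E}) : mobius G G = 1.
Proof. by rewrite /Defs.mobius; case: #|E| => [|n] /=; rewrite eqxx. Qed.

Lemma mobius_proper (G F : {set E}) : G \proper F ->
  mobius G F = - \sum_(K : {set E} | [&& flat K, G \subset K & K \proper F]) mobius G K.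
Proof.
move=> pGF; have sGF := proper_sub pGF.
have gt0 : (0 < #|F :\: G|)%N by rewrite card_gt0 setD_eq0; case/andP: pGF.
have leFE : (#|F :\: G| <= #|E|)%N by exact: max_card.
rewrite {1}/Defs.mobius -(prednK (leq_trans gt0 leFE)) /=.
rewrite (_ : G == F = false); last by apply/negbTE; rewrite proper_neq.
congr (- _); apply: eq_bigr => K /and3P[fK sGK pKF].
have ltK : (#|K :\: G| < #|E|)%N.
  have /properP[_ [x xF xK]] := pKF.
  rewrite -cardsT; apply: proper_card; apply/properP; split; first exact: subsetT.
  by exists x; rewrite // inE (negPf xK) andbF.
by apply: mobius_rec_fuel => //; [rewrite -ltnS prednK // (leq_ltn_trans _ ltK)|apply: ltnW].
Qed.

Lemma sum_mobius (G F : {set E}) : flat F -> G \subset F ->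
  \sum_(K : {set E} | [&& flat K, G \subset K & K \subset F]) mobius G K = (G == F)%:R.
Proof.
move=> fF sGF; rewrite (bigD1 F) /=; last by rewrite fF sGF subxx.
have [->|neGF] := eqVneq G F.
  rewrite mobiusGG big1 ?addr0 // => K /andP[/and3P[_ sFK sKF]].
  by rewrite eqEsubset sFK sKF.
rewrite mobius_proper ?properEneq ?neGF //.
apply/eqP; rewrite addrC subr_eq0; apply/eqP; apply: eq_bigl => K.
by rewrite properEneq -!andbA; congr [&& _, _ & _]; rewrite andbC.
Qed.

(* The Moebius matrix is a one-sided, hence two-sided, inverse of the zeta
   matrix. *)
Lemma sum_mobius_dual (G F : {set E}) : flat G -> flat F -> G \subset F ->
  \sum_(K : {set E} | [&& flat K, G \subset K & K \subset F]) mobius K F = (G == F)%:R.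
Proof.
move=> fG fF sGF.
pose le (A B : {set E}) := [&& flat A, flat B & A \subset B].
pose s (i : 'I_#|{set E}|) : {set E} := enum_val i.
(* Outside the order on flats the entries are those of the identity, so that square matrices can be
   indexed by all subsets. *)
pose M := \matrix_(i, j) (if le (s i) (s j) then mobius (s i) (s j) else (i == j)%:R).
pose Z := \matrix_(i, j) ((le (s i) (s j) || (i == j))%:R : int).
have sumE (h : {set E} -> int) : \sum_i h (s i) = \sum_A h A.
  by rewrite (reindex (@enum_val _ (mem {set E}))) //; exact: onW_bij (enum_val_bij _).
have s_inj : injective s := enum_val_inj.
have MZ : M *m Z = 1%:M.
  apply/matrixP=> i j; rewrite !mxE.
  under eq_bigr do rewrite !mxE -!(inj_eq s_inj).
  rewrite -(inj_eq s_inj) (sumE (fun A => (if le (s i) A then mobius (s i) A else (s i == A)%:R) *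
     (le A (s j) || (A == s j))%:R)).
  have [fi|nfi] := boolP (flat (s i)); last first.
    rewrite (bigD1 (s i)) //= /le (negPf nfi) /= eqxx mul1r big1 ?addr0 // => A.
    by rewrite eq_sym => /negPf->; rewrite mul0r.
  have [fj|nfj] := boolP (flat (s j)); last first.
    rewrite (bigD1 (s j)) //= /le (negPf nfj) /= !andbF eqxx ?orbT mulr1 big1 ?addr0 //.
    by move=> A /negPf->; rewrite andbF mulr0.
  have [sij|nsij] := boolP (s i \subset s j); last first.
    rewrite [RHS](_ : _ = 0); last by case: eqP nsij => // ->; rewrite subxx.
    rewrite big1 // => A _.
    rewrite /le fi fj /=; case: andP => [[fA siA]|].
      rewrite (_ : _ || _ = false) ?mulr0 //; apply/negbTE; apply: contra nsij.
      by case/orP=> [/andP[_]|/eqP<-//]; apply: subset_trans.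
    case: eqP => [<-|]; last by rewrite mul0r.
    by rewrite fi subxx => -[].
  rewrite -(sum_mobius fj sij) [RHS]big_mkcond /=; apply: eq_bigr => A _.
  rewrite /le fi fj /=; have [fA|nfA] /= := boolP (flat A); last first.
    rewrite (_ : s i == A = false) ?mul0r //.
    by apply/eqP=> eA; rewrite -eA fi in nfA.
  case: ifP => [sA|nsA] /=.
    have -> : (A \subset s j) || (A == s j) = (A \subset s j).
      by case: eqP => [->|]; rewrite ?subxx ?orbF.
    by case: ifP; rewrite ?mulr1 ?mulr0.
  rewrite (_ : s i == A = false) ?mul0r //.
  by apply/eqP=> eA; rewrite -eA subxx in nsA.
have /matrixP/(_ (enum_rank G) (enum_rank F)) := mulmx1C MZ.
rewrite !mxE (inj_eq enum_rank_inj) => <-.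
under [RHS]eq_bigr do rewrite !mxE -!(inj_eq s_inj) /s !enum_rankK -/(s _).
rewrite (sumE (fun A => (le G A || (G == A))%:R * (if le A F then mobius A F else (A == F)%:R))).
rewrite big_mkcond; apply: eq_bigr => A _; rewrite /le fG fF /=.
have [fA|nfA] /= := boolP (flat A); last first.
  rewrite (_ : G == A = false) /= ?mul0r //.
  by apply/eqP=> eA; rewrite -eA fG in nfA.
have -> : (G \subset A) || (G == A) = (G \subset A).
  by case: eqP => [->|]; rewrite ?subxx ?orbF.
case: (G \subset A); rewrite ?mul0r // mul1r /=; case: ifP => // nsAF.
by case: eqP nsAF => // ->; rewrite subxx.
Qed.

Lemma size_chi (G F : {set E}) : (size (chi G F) <= (rk F - rk G).+1)%N.
Proof.
apply: (leq_trans (size_sum _ _ _)); apply/bigmax_leqP=> K /and3P[_ sGK _].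
apply: leq_trans (size_scale_leq _ _) _; rewrite size_polyXn ltnS.
exact: leq_sub2l (rk_mono sGK).
Qed.

Lemma chiGG (G : {set E}) : flat G -> chi G G = 1.
Proof.
move=> fG; rewrite /char_poly_int (big_pred1 G) ?mobiusGG ?subnn ?scale1r ?expr0 //.
move=> K /=; rewrite -eqEsubset eq_sym.
by apply/andP/eqP=> [[_ /eqP]|->].
Qed.

Lemma rev_chi (G F : {set E}) : flat G -> flat F ->
  revpoly (rk F - rk G) (chi G F) =
  \sum_(K : {set E} | [&& flat K, G \subset K & K \subset F]) mobius G K *: 'X^(rk K - rk G).
Proof.
move=> fG fF; rewrite linear_sum; apply: eq_bigr => K /and3P[_ sGK sKF].
have [] := (rk_mono sGK, rk_mono sKF) => leGK leKF.
by rewrite linearZ /= revpolyXn; [congr (_ *: 'X^_); lia | lia].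
Qed.

(* [chi] is a kernel in the sense of Stanley: the convolution inverse of [chi]
   is its reversal. *)
Lemma rev_chi_mul_chi (G K : {set E}) : flat G -> flat K -> G \subset K ->
  \sum_(F : {set E} | [&& flat F, G \subset F & F \subset K])
    revpoly (rk F - rk G) (chi G F) * chi F K = (G == K)%:R.
Proof.
move=> fG fK sGK.
(* The expansion runs over chains from [G] through [J], [F], [I] to [K], and the exponent does not
   involve [F]: the sum over [F] forces [I = J], and then the sum over [J] forces [G = K]. *)
pose t (J F I : {set E}) := (mobius G J * mobius F I) *: 'X^((rk J - rk G) + (rk K - rk I)) : {poly int}.
transitivity (\sum_(J : {set E} | [&& flat J, G \subset J & J \subset K])
   \sum_(I : {set E} | [&& flat I, J \subset I & I \subset K])
   \sum_(F : {set E} | [&& flat F, J \subset F & F \subset I]) t J F I).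
  transitivity (\sum_(F : {set E} | [&& flat F, G \subset F & F \subset K])
     \sum_(J : {set E} | [&& flat J, G \subset J & J \subset F])
     \sum_(I : {set E} | [&& flat I, F \subset I & I \subset K]) t J F I).
    apply: eq_bigr => F /and3P[fF sGF sFK].
    rewrite rev_chi // mulr_suml; apply: eq_bigr => J _.
    rewrite mulr_sumr; apply: eq_bigr => I _.
    by rewrite -scalerAl -scalerAr scalerA -exprD.
  rewrite (exchange_big_dep (fun J : {set E} => [&& flat J, G \subset J & J \subset K])) /=; last first.
    move=> F J /and3P[_ _ sFK] /and3P[-> -> sJF] /=; exact: (subset_trans sJF sFK).
  apply: eq_bigr => J /and3P[fJ sGJ sJK].
  rewrite (exchange_big_dep (fun I : {set E} => [&& flat I, J \subset I & I \subset K])) /=; last first.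
    move=> F I /andP[_ /and3P[_ _ sJF]] /and3P[-> sFI ->]; rewrite andbT /=; exact: (subset_trans sJF sFI).
  apply: eq_bigr => I /and3P[fI sJI sIK]; apply: eq_bigl => F.
  rewrite fJ fI sGJ sIK /= andbT; apply/idP/idP.
    by case/andP=> /andP[/and3P[-> _ _] ->] ->.
  case/and3P=> -> sJF sFI; rewrite sJF sFI (subset_trans sGJ) //= !andbT.
  exact: (subset_trans sFI sIK).
transitivity (\sum_(J : {set E} | [&& flat J, G \subset J & J \subset K])
   mobius G J *: ('X^(rk K - rk G) : {poly int})); last first.
  rewrite -scaler_suml sum_mobius //; case: eqP => [->|_]; last by rewrite scale0r.
  by rewrite subnn expr0 scale1r.
apply: eq_bigr => J /and3P[fJ sGJ sJK].
rewrite (bigD1 J) /=; last by rewrite fJ subxx sJK.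
rewrite [X in _ + X]big1 ?addr0 => [|I /andP[/and3P[fI sJI sIK] neIJ]]; last first.
  rewrite -scaler_suml -mulr_sumr sum_mobius_dual // eq_sym (negPf neIJ).
  by rewrite mulr0 scale0r.
rewrite -scaler_suml -mulr_sumr sum_mobius_dual // eqxx mulr1.
have [] := (rk_mono sGJ, rk_mono sJK) => leGK leKF.
by congr (_ *: 'X^_); lia.
Qed.

(** The clause of [KL_family] at the single flat [G]. It only involves the values of [P] at sets
    containing [G], which permits a construction by downward induction. *)
Definition KL_at (P : {set E} -> {poly int}) (G : {set E}) : Prop :=
  let r := (rk [set: E] - rk G)%N in
  [/\ r = 0%N -> P G = 1,
      (0 < r)%N -> ((size (P G)).-1.*2 < r)%N
    & revpoly r (P G) =
      \sum_(F : {set E} | flat F && (G \subset F)) chi G F * P F].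

Lemma KL_at_size P G : KL_at P G -> (size (P G) <= (rk [set: E] - rk G).+1)%N.
Proof.
case=> P0 P1 _; case: (posnP (rk [set: E] - rk G)) => [r0|/P1].
  by rewrite r0 P0 // size_poly1.
lia.
Qed.

(** Take for [p] the part of [- Q] of degree below r/2; by antisymmetry its reversal is the part of
    [Q] above r/2. *)
Lemma split_antipalindromic r (Q : {poly int}) :
  (size Q <= r.+1)%N -> revpoly r Q = - Q ->
  exists p : {poly int}, (size p <= uphalf r)%N /\ revpoly r p = Q + p.
Proof.
move=> sQ antiQ; exists (\poly_(i < uphalf r) - Q`_i); split; first exact: size_poly.
have Qi i : (i <= r)%N -> Q`_(r - i) = - Q`_i.
  by move=> le_ir; have /polyP/(_ i) := antiQ; rewrite coef_revpoly le_ir coefN.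
apply/polyP=> i; rewrite coef_revpoly coefD !coef_poly.
case: (leqP i r) => [le_ir|lt_ri]; last first.
  by rewrite nth_default ?(leq_trans sQ) // ifF ?addr0 //; lia.
have := Qi i le_ir; case: (ltngtP (i.*2) r) => [lt|gt|eq] E1.
- by rewrite ifF ?ifT ?subrr //; lia.
- by rewrite ifT ?ifF ?E1 ?opprK ?addr0 //; lia.
(* The middle coefficient, present for even [r], is its own opposite. *)
rewrite !ifF ?addr0; try lia.
move: E1; rewrite (_ : r - i = i)%N; [lia | lia].
Qed.

(** The recursion at [G] reads [revpoly r p = Q + p], where [Q] collects the terms of the larger
    flats. It has a solution of small degree because [Q] is antisymmetric. *)
Lemma KL_extend (P : {set E} -> {poly int}) (G : {set E}) : flat G ->
  (forall F, flat F -> G \proper F -> KL_at P F) ->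
  exists p, KL_at (fun F => if F == G then p else P F) G.
Proof.
move=> fG KLP; set r := (rk [set: E] - rk G)%N.
pose Q := \sum_(F : {set E} | flat F && (G \proper F)) chi G F * P F.
have sumQ p : \sum_(F : {set E} | flat F && (G \subset F))
    chi G F * (if F == G then p else P F) = Q + p.
  rewrite (bigD1 G) /=; last by rewrite fG subxx.
  rewrite eqxx chiGG // mul1r addrC; congr (_ + _).
  rewrite /Q; apply: eq_big => [F|F /andP[_ /negPf->] //].
  by rewrite properEneq -andbA (eq_sym G) [_ && (F != G)]andbC.
have [r0|r_gt0] := posnP r.
  exists 1; rewrite /KL_at eqxx -/r r0 sumQ; split=> //.
  rewrite (_ : Q = 0); last first.
    rewrite /Q big1 // => F /andP[fF pGF].
    by have := rk_flat_proper fG pGF; have := rk_mono (subsetT F); rewrite -/r in r0 *; lia.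
  by rewrite add0r -(expr0 'X) revpolyXn.
have rkF (F : {set E}) : G \subset F -> ((rk F - rk G) + (rk [set: E] - rk F) = r)%N.
  by move=> sGF; have := (rk_mono sGF, rk_mono (subsetT F)) => -[]; rewrite /r; lia.
have sQ : (size Q <= r.+1)%N.
  apply: (leq_trans (size_sum _ _ _)); apply/bigmax_leqP=> F /andP[fF pGF].
  apply: leq_trans (size_polyMleq _ _) _.
  have := size_chi G F; have := KL_at_size (KLP F fF pGF).
  have := rkF F (proper_sub pGF); lia.
(* Reversing each factor and substituting the recursion for each [P F] produces the kernel identity
   without its term [F = G]; that term is [chi G K], whence the sign. *)
have antiQ : revpoly r Q = - Q.
  rewrite /Q linear_sum /=.
  transitivity (\sum_(F : {set E} | flat F && (G \proper F))
     \sum_(K : {set E} | flat K && (F \subset K))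
        (revpoly (rk F - rk G) (chi G F) * chi F K) * P K).
    apply: eq_bigr => F /andP[fF pGF].
    rewrite -(rkF F (proper_sub pGF)) revpolyM ?size_chi ?(KL_at_size (KLP F fF pGF)) //.
    have [_ _ ->] := KLP F fF pGF.
    by rewrite mulr_sumr; apply: eq_bigr => K _; rewrite mulrA.
  rewrite (exchange_big_dep (fun K : {set E} => flat K && (G \proper K))) /=; last first.
    by move=> F K /andP[_ pGF] /andP[-> sFK] /=; apply: proper_sub_trans sFK.
  rewrite -sumrN; apply: eq_bigr => K /andP[fK pGK].
  rewrite -mulr_suml -mulNr; congr (_ * _); apply/eqP.
  rewrite -addr_eq0 addrC -[X in X + _]mul1r -(_ : revpoly (rk G - rk G) (chi G G) = 1); last first.
    by rewrite subnn chiGG // -(expr0 'X) revpolyXn.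
  have := rev_chi_mul_chi fG fK (proper_sub pGK).
  rewrite (negPf (proper_neq pGK)) (bigD1 G) /= => [|]; last by rewrite fG subxx proper_sub.
  move=> E0; apply/eqP; rewrite -[RHS]E0; congr (_ + _); apply: eq_bigl => F.
  rewrite fK properEneq (eq_sym G) /=; apply/idP/idP.
    by case/andP=> /andP[-> /andP[-> ->]] ->.
  by case/andP=> /and3P[-> -> ->] ->.
have [p [sp revp]] := split_antipalindromic sQ antiQ.
exists p; rewrite /KL_at eqxx -/r sumQ; split=> //.
- by move=> r0; rewrite r0 in r_gt0.
- by move=> _; move: sp r_gt0; lia.
Qed.

Lemma eq_KL_at (P P' : {set E} -> {poly int}) (G : {set E}) :
  (forall F : {set E}, G \subset F -> P F = P' F) -> KL_at P G -> KL_at P' G.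
Proof.
move=> eqP [P0 P1 P2]; rewrite /KL_at -(eqP G (subxx G)); split=> //.
by rewrite P2; apply: eq_bigr => F /andP[_ sGF]; rewrite eqP.
Qed.

Lemma KL_exists : exists P, KL_family rk P.
Proof.
suff [P KLP] : exists P, forall G : {set E}, (#|~: G| < #|E|.+1)%N -> flat G -> KL_at P G.
  by exists P => G; apply: KLP; rewrite ltnS max_card.
(* Stage [m] of the induction defines [P] on the sets whose complement has [m] elements. *)
elim: #|E|.+1 => [|m [P KLP]]; first by exists (fun=> 0).
have ltC (F G : {set E}) : G \proper F -> (#|~: F| < #|~: G|)%N.
  by move=> pGF; rewrite proper_card // properC.
have ex (G : {set E}) : exists p, (#|~: G| == m) && flat G ->
    KL_at (fun F => if F == G then p else P F) G.
  have [/andP[/eqP cG fG]|] := boolP ((#|~: G| == m) && flat G); last by exists 0.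
  have [|p KLp] := @KL_extend P G fG; last by exists p.
  by move=> F fF pGF; apply: KLP => //; rewrite -cG ltC.
have [p KLp] : exists p : {ffun {set E} -> {poly int}}, forall G, (#|~: G| == m) && flat G ->
    KL_at (fun F => if F == G then p G else P F) G.
  have /fin_all_exists[p Hp] := ex; exists (finfun p) => G; rewrite ffunE; exact: Hp.
exists (fun G => if #|~: G| == m then p G else P G) => G.
rewrite ltnS leq_eqVlt => /orP[cG|cG] fG.
  apply: eq_KL_at (KLp G _) => [F sGF|]; last by rewrite cG.
  have [->|neFG] := eqVneq F G; first by rewrite cG.
  rewrite ifF //; apply/negbTE; rewrite -(eqP cG) neq_ltn ltC //.
  by rewrite properEneq eq_sym neFG.
apply: eq_KL_at (KLP G cG fG) => F sGF; rewrite ifF //; apply/negbTE.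
by rewrite neq_ltn (leq_ltn_trans _ cG) // subset_leq_card // setCS.
Qed.

(** * Coefficients of degree 0 and 1 *)

Lemma coef_chi_top (G F : {set E}) : flat G -> flat F -> G \subset F ->
  (chi G F)`_(rk F - rk G) = 1.
Proof.
move=> fG fF sGF; rewrite coef_sum (bigD1 G) /=; last by rewrite fG subxx.
rewrite coefZ coefXn eqxx mobiusGG mulr1 big1 ?addr0 // => K.
case/andP=> /and3P[fK sGK sKF] neKG.
have ltGK : (rk G < rk K)%N by rewrite rk_flat_proper // properEneq eq_sym neKG.
have leKF := rk_mono sKF.
by rewrite coefZ coefXn (_ : _ == _ = false) ?mulr0 //; apply/negbTE; lia.
Qed.

(** Only the flats covering [G] contribute to this degree, and there the Moebius function is -1. *)
Lemma coef_chi_subtop (G : {set E}) : flat G -> (rk G < rk [set: E])%N ->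
  (chi G [set: E])`_(rk [set: E] - rk G).-1 =
  - #|[set F : {set E} | [&& flat F, G \subset F & rk F == (rk G).+1]]|%:R.
Proof.
move=> fG ltG; rewrite coef_sum -sumr_const -sumrN.
rewrite [RHS]big_mkcond [LHS]big_mkcond /=; apply: eq_bigr => K _.
rewrite inE subsetT andbT coefZ coefXn.
case fK: (flat K) => //=; case sGK: (G \subset K) => //=.
have leKT := rk_mono (subsetT K).
case: eqP => [rkK|neK]; last first.
  have [->|neGK] := eqVneq G K.
    by rewrite (_ : _ == _ = false) ?mulr0 //; apply/negbTE; lia.
  have ltGK : (rk G < rk K)%N by rewrite rk_flat_proper // properEneq neGK.
  by rewrite (_ : _ == _ = false) ?mulr0 //; apply/negbTE; lia.
rewrite (_ : _ == _ = true) ?mulr1; last by apply/eqP; lia.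
have pGK : G \proper K.
  by rewrite properEneq sGK andbT; apply/eqP=> eGK; rewrite eGK in rkK ltG; lia.
rewrite mobius_proper // (big_pred1 G) ?mobiusGG // => J /=.
apply/idP/eqP=> [/and3P[fJ sGJ pJK]|->]; last by rewrite fG subxx.
apply/eqP/negP => /negP neJG.
have ltGJ : (rk G < rk J)%N by rewrite rk_flat_proper // properEneq eq_sym neJG.
by have := rk_flat_proper fJ pJK; lia.
Qed.

(** The boolean pays for the constant polynomial 1 in rank 0, which the degree bound does not
    cover. *)
Lemma size_KL P G : KL_family rk P -> flat G ->
  (size (P G) <= uphalf (rk [set: E] - rk G) + (rk G == rk [set: E]))%N.
Proof.
move=> KLP fG; have [P0 P1 _] := KLP G fG.
have := rk_mono (subsetT G).
have [r0|r_gt0] := posnP (rk [set: E] - rk G).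
  by rewrite (P0 r0) size_poly1; case: eqP; lia.
by have := P1 r_gt0; case: eqP; lia.
Qed.

Lemma size_chi_mul_KL P (G F : {set E}) : KL_family rk P -> flat F -> G \subset F ->
  (size (chi G F * P F)%R <=
   (rk F - rk G) + uphalf (rk [set: E] - rk F) + (rk F == rk [set: E]))%N.
Proof.
move=> KLP fF sGF; apply: leq_trans (size_polyMleq _ _) _.
have := size_chi G F; have := size_KL KLP fF; lia.
Qed.

Lemma KL_family_T P (F : {set E}) : KL_family rk P -> flat F -> rk F = rk [set: E] -> P F = 1.
Proof. by move=> KLP fF rkF; have [-> //] := KLP F fF; rewrite rkF subnn. Qed.

Lemma flat_full (F : {set E}) : flat F -> rk F = rk [set: E] -> F = [set: E].
Proof.
move=> fF rkF; apply/eqP; rewrite eqEsubset subsetT /=; apply/negPn/negP => nsub.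
by have := rk_flat_proper fF (_ : F \proper [set: E]); rewrite /proper subsetT nsub rkF ltnn => /(_ isT).
Qed.

(** In the top degree of the recursion only [F = [set: E]] survives: for smaller flats the degree
    bound on [P F] makes the degree of the product drop. *)
Lemma KL_family_coef0 P G : KL_family rk P -> flat G -> (P G)`_0 = 1.
Proof.
move=> KLP fG; have [P0 _ /polyP/(_ (rk [set: E] - rk G)%N)] := KLP G fG.
rewrite coef_revpoly leqnn subnn => ->; rewrite coef_sum.
have leGT := rk_mono (subsetT G).
rewrite (bigD1 [set: E]) /=; last by rewrite flatT subsetT.
rewrite (KL_family_T KLP flatT) // mulr1 coef_chi_top ?flatT ?subsetT //.
rewrite big1 ?addr0 // => F /andP[/andP[fF sGF] neF].
rewrite nth_default //; apply: leq_trans (size_chi_mul_KL KLP fF sGF) _.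
have := rk_mono sGF; have := rk_mono (subsetT F).
have : rk F != rk [set: E] by apply: contra neF => /eqP/(flat_full fF)->.
by move=> /negPf->; lia.
Qed.

(** One degree below the top, the full set contributes minus the number of atoms over [G], and each
    flat of corank 1 contributes a leading coefficient 1, since [P F = 1] there; larger coranks give
    too small a degree. *)
Lemma KL_family_coef1 P G : KL_family rk P -> flat G -> (rk G < rk [set: E])%N ->
  (P G)`_1 =
  #|[set F : {set E} | [&& flat F, G \subset F & (rk F).+1 == rk [set: E]]]|%:R
  - #|[set F : {set E} | [&& flat F, G \subset F & rk F == (rk G).+1]]|%:R.
Proof.
move=> KLP fG ltG; have [_ _ /polyP/(_ (rk [set: E] - rk G).-1)] := KLP G fG.
rewrite coef_revpoly leq_pred (_ : _ - _.-1 = 1)%N; last by lia.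
move=> ->; rewrite coef_sum.
rewrite (bigD1 [set: E]) /=; last by rewrite flatT subsetT.
rewrite (KL_family_T KLP flatT) // mulr1 coef_chi_subtop // addrC; congr (_ - _).
rewrite -sumr_const [RHS]big_mkcond [LHS]big_mkcond /=; apply: eq_bigr => F _.
rewrite inE; case fF: (flat F) => //=; case sGF: (G \subset F) => //=.
have [leGF leFT] := (rk_mono sGF, rk_mono (subsetT F)).
have [->|neF] := eqVneq F [set: E]; first by rewrite ifF //; apply/negbTE; lia.
have {neF} : rk F != rk [set: E] by apply: contra neF => /eqP/(flat_full fF)->.
move=> neF /=; case: eqP => [rkF|ne_rkF]; last first.
  rewrite nth_default //; apply: leq_trans (size_chi_mul_KL KLP fF sGF) _.
  have ltFT : ((rk F).+1 < rk [set: E])%N.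
    by rewrite ltn_neqAle ltn_neqAle neF leFT !andbT; apply/eqP.
  by move: neF => /negPf->; lia.
have -> : ((rk [set: E] - rk G).-1 = (rk F - rk G) + 0)%N by lia.
have PF1 : P F = 1.
  apply/polyP=> i; rewrite coef1; case: i => [|i]; first exact: KL_family_coef0.
  by rewrite nth_default // (leq_trans (size_KL KLP fF)) // (negPf neF); lia.
by rewrite PF1 mulr1 addn0 coef_chi_top.
Qed.

(** * Matroid rank functions: loops and atoms *)

Section Submodular.

Hypothesis rk0 : rk set0 = 0%N.
Hypothesis rk_submod : forall A B : {set E}, (rk (A :|: B) + rk (A :&: B) <= rk A + rk B)%N.

Lemma mem_cl0 x : (x \in cl rk set0) = (rk [set x] == 0)%N.
Proof. by rewrite inE setU0 rk0. Qed.

Lemma rk_loops (A : {set E}) : (forall x, x \in A -> rk [set x] = 0%N) -> rk A = 0%N.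
Proof.
have [m] := ubnP #|A|; elim: m A => // m IHm A leA loopA.
have [->//|[x xA]] := set_0Vmem A.
have := rk_submod [set x] (A :\ x); rewrite setD1K // loopA //.
rewrite (IHm (A :\ x)) => [|| y /setD1P[_ /loopA]//]; first by lia.
by rewrite (cardsD1 x A) xA in leA; rewrite -ltnS.
Qed.

Lemma rk_cl0 : rk (cl rk set0) = 0%N.
Proof. by apply: rk_loops => x; rewrite mem_cl0 => /eqP. Qed.

Lemma flat_cl0 : flat (cl rk set0).
Proof.
apply/forallP=> x; apply/implyP; rewrite mem_cl0 rk_cl0 -lt0n => /leq_trans; apply.
by rewrite rk_mono // subsetUl.
Qed.

(** Lets the coatoms and atoms above the least flat be counted among all flats. *)
Lemma cl0_sub_flat (F : {set E}) : flat F -> cl rk set0 \subset F.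
Proof.
move=> fF; apply/subsetP=> x; rewrite mem_cl0 => /eqP x0.
apply/negPn/negP => xF; have /forallP/(_ x)/implyP/(_ xF) := fF.
by have := rk_submod [set x] F; rewrite x0; lia.
Qed.

(** A flat of rank 1 is the closure of any of its non-loops, so closures of single elements exhaust
    these flats. *)
Lemma card_flats_rk1 : (#|[set F : {set E} | flat F && (rk F == 1)]| <= #|E|)%N.
Proof.
have cl1 (F : {set E}) : flat F -> rk F = 1%N -> exists x, F = cl rk [set x].
  move=> fF rkF.
  have [x xF x_gt0] : exists2 x, x \in F & (0 < rk [set x])%N.
    have [x /andP[]|none] := pickP (fun x => (x \in F) && (0 < rk [set x])%N); first by exists x.
    suff : rk F = 0%N by rewrite rkF.
    apply: rk_loops => x xF.
    by have := none x; rewrite xF /= lt0n => /negbFE/eqP.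
  have rkx : rk [set x] = 1%N.
    by have : (rk [set x] <= rk F)%N by [rewrite rk_mono ?sub1set]; lia.
  exists x; apply/setP=> y; rewrite inE rkx; apply/idP/eqP=> [yF|rkxy].
    have : (rk (y |: [set x]) <= rk F)%N by rewrite rk_mono // subUset !sub1set yF.
    by have : (rk [set x] <= rk (y |: [set x]))%N by [rewrite rk_mono ?subsetUr]; lia.
  apply/negPn/negP => yF; have /forallP/(_ y)/implyP/(_ yF) := fF.
  have := rk_submod (y |: [set x]) F.
  have xUF : [set x] :|: F = F by apply/setUidPr; rewrite sub1set.
  rewrite -setUA xUF setIC => le.
  have : (rk [set x] <= rk (F :&: (y |: [set x])))%N.
    by rewrite rk_mono // sub1set !inE xF eqxx orbT.
  by lia.
apply: leq_trans (leq_imset_card (fun x => cl rk [set x]) E).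
apply/subset_leq_card/subsetP=> F; rewrite inE => /andP[fF /eqP rkF].
by have [x ->] := cl1 F fF rkF; apply/imsetP; exists x.
Qed.

Lemma KL_poly_coef1 :
  #|[set F : {set E} | flat F && ((rk F).+1 == rk [set: E])]|%:Z - #|E|%:Z
  <= (KL_poly rk)`_1.
Proof.
(* [xget] picks a solution as soon as one exists, and the coefficient formula holds for every
   solution. *)
have [P KLP KLE] : is_KL_poly rk (KL_poly rk).
  have [P KLP] := KL_exists.
  by apply: classical_sets.xgetPex; exists (P (cl rk set0)); exists P.
rewrite KLE; case: (posnP (rk [set: E])) => [T0|T_gt0].
  (* In rank 0 the polynomial is 1 and there is no coatom, so the left side is at most 0. *)
  rewrite (KL_family_T KLP flat_cl0) ?rk_cl0 // coef1 /=.
  by rewrite (_ : [set _ | _] = set0) ?cards0 //; [lia|apply/setP=> F; rewrite !inE T0 andbF].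
rewrite (KL_family_coef1 KLP flat_cl0) ?rk_cl0 // !natz.
have := card_flats_rk1.
rewrite (_ : [set F : {set E} | [&& flat F, cl rk set0 \subset F & (rk F).+1 == rk [set: E]]]
   = [set F : {set E} | flat F && ((rk F).+1 == rk [set: E])]); last first.
  by apply/setP=> F; rewrite !inE; case fF: (flat F) => //=; rewrite cl0_sub_flat.
rewrite (_ : [set F : {set E} | [&& flat F, cl rk set0 \subset F & rk F == 1%N]]
   = [set F : {set E} | flat F && (rk F == 1%N)]); last first.
  by apply/setP=> F; rewrite !inE; case fF: (flat F) => //=; rewrite cl0_sub_flat.
lia.
Qed.

End Submodular.

End KLPolynomials.

(** * Antisymmetrizers and Specht modules *)

Section ArrangementRank.

Variables (K : fieldType) (V : vectType K) (A : arrangement V).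

Definition arr_core (B : {set arr_ground A}) : {vspace V} :=
  (arr_space A :&: \bigcap_(H in B) ssval H)%VS.

Lemma memv_core (B : {set arr_ground A}) v :
  reflect (v \in arr_space A /\ forall H, H \in B -> v \in ssval H) (v \in arr_core B).
Proof.
rewrite memv_cap [X in _ && X]memvE.
apply: (iffP andP) => -[vW vB]; split=> //.
  by move=> H HB; have /subv_bigcapP/(_ H HB) := vB.
by apply/subv_bigcapP=> H HB; rewrite -memvE; apply: vB.
Qed.

Lemma arr_rankE B : arr_rank B = (\dim (arr_space A) - \dim (arr_core B))%N.
Proof. by []. Qed.

Lemma dim_core B : (\dim (arr_core B) <= \dim (arr_space A))%N.
Proof. by rewrite dimvS // capvSl. Qed.

Lemma core_subset (B C : {set arr_ground A}) : B \subset C -> (arr_core C <= arr_core B)%VS.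
Proof.
move=> /subsetP sBC; apply/subvP=> v /memv_core[vW vC]; apply/memv_core.
by split=> // H /sBC/vC.
Qed.

Lemma arr_rank0 : arr_rank (set0 : {set arr_ground A}) = 0%N.
Proof. by rewrite arr_rankE /arr_core big_set0 capvf subnn. Qed.

Lemma arr_rank_mono (B C : {set arr_ground A}) : B \subset C -> (arr_rank B <= arr_rank C)%N.
Proof. by move=> sBC; rewrite !arr_rankE leq_sub2l // dimvS // core_subset. Qed.

(** The core of a union is the intersection of the cores, and the core of an intersection contains
    their sum; the dimension formula concludes. *)
Lemma arr_rank_submod (B C : {set arr_ground A}) :
  (arr_rank (B :|: C) + arr_rank (B :&: C) <= arr_rank B + arr_rank C)%N.
Proof.
have eqU : arr_core (B :|: C) = (arr_core B :&: arr_core C)%VS.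
  apply/vspaceP=> v; rewrite memv_cap; apply/idP/andP.
    by move=> /memv_core[vW vBC]; split; apply/memv_core; split=> // H HB;
       apply: vBC; rewrite inE HB ?orbT.
  case=> /memv_core[vW vB] /memv_core[_ vC]; apply/memv_core; split=> // H.
  by rewrite inE => /orP[/vB|/vC].
have leI : (\dim (arr_core B + arr_core C) <= \dim (arr_core (B :&: C)))%N.
  by rewrite dimvS // subv_add !core_subset ?subsetIl ?subsetIr.
have := dimv_sum_cap (arr_core B) (arr_core C); rewrite -eqU.
rewrite !arr_rankE; have := (dim_core (B :&: C)); have := dim_core B; have := dim_core C.
have : (\dim (arr_core (B :|: C)) <= \dim (arr_core B))%N by rewrite dimvS // core_subset ?subsetUl.
have : (\dim (arr_core (B :|: C)) <= \dim (arr_core C))%N by rewrite dimvS // core_subset ?subsetUr.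
lia.
Qed.

(** The core of [F] exceeds the common kernel by one line, so [F] has corank 1; any further
    hyperplane misses [psi] and lowers the dimension, so [F] is flat. *)
Lemma arr_coatom psi (F := [set H : arr_ground A | psi \in ssval H]) :
  psi \in arr_space A -> psi \notin arr_core setT ->
  (arr_core F <= arr_core setT + <[psi]>)%VS ->
  flat (@arr_rank K V A) F && ((arr_rank F).+1 == arr_rank [set: arr_ground A]).
Proof.
move=> psiW psiNT sF.
have psiF : psi \in arr_core F by apply/memv_core; split=> // H; rewrite inE.
have dimF : \dim (arr_core F) = (\dim (arr_core setT)).+1.
  have -> : arr_core F = (arr_core setT + <[psi]>)%VS.
    apply/eqP; rewrite eqEsubv sF subv_add core_subset ?subsetT //=.
  rewrite dimv_disjoint_sum ?dim_vline.
    by rewrite (_ : psi != 0) ?addn1 //; apply: contra psiNT => /eqP->; rewrite mem0v.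
  apply/eqP; rewrite -subv0; apply/subvP=> v; rewrite memv_cap => /andP[vT /vlineP[a va]].
  rewrite memv0; move: vT; rewrite va; have [->|a0] := eqVneq a 0; first by rewrite scale0r.
  by rewrite rpredZeq (negPf a0) (negPf psiNT).
have := dim_core F; rewrite dimF => ltT.
apply/andP; split; last by rewrite !arr_rankE dimF; lia.
apply/forallP=> H; apply/implyP=> HF; rewrite !arr_rankE.
have := dim_core F; suff : (\dim (arr_core (H |: F)) < \dim (arr_core F))%N by lia.
rewrite ltn_neqAle; have /dimv_leqif_eq[-> ->] := core_subset (subsetUr [set H] F).
rewrite andbT; apply: contra HF => /eqP coreE.
by move: psiF; rewrite -coreE inE => /memv_core[_]; apply; rewrite !inE eqxx.
Qed.

End ArrangementRank.

(** * Permutation action, antisymmetrizers and polytabloids *)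

Section Action.

Variables (K : numFieldType) (n : nat).
Implicit Types (v : word_space K n) (w : word n) (s p : 'S_n) (A B : {set 'I_n}).

Definition wcomp w s : word n := [ffun x => w (s x)].

Lemma word_actE s v w : word_act s v w = v (wcomp w s).
Proof. by rewrite ffunE. Qed.

Lemma word_act1 v : word_act 1 v = v.
Proof. by apply/ffunP=> w; rewrite word_actE; congr (v _); apply/ffunP=> x; rewrite ffunE perm1. Qed.

Lemma word_actM s p v : word_act s (word_act p v) = word_act (p * s)%g v.
Proof.
apply/ffunP=> w; rewrite !word_actE; congr (v _).
by apply/ffunP=> x; rewrite !ffunE permM.
Qed.

Lemma sgn_mulss s : (-1) ^+ s * (-1) ^+ s = 1 :> K.
Proof. by rewrite -signr_addb addbb. Qed.

(** The antisymmetrizer of the symmetric group of [A], not divided by the group order. *)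
Definition alt A v : word_space K n :=
  \sum_(s : 'S_n | perm_on A s) (-1) ^+ s *: word_act s v.

Fact alt_is_linear A : linear (alt A).
Proof.
move=> a u v; rewrite /alt scaler_sumr -big_split /=; apply: eq_bigr => s _.
by rewrite linearP scalerDr !scalerA mulrC.
Qed.

HB.instance Definition _ A :=
  GRing.isLinear.Build K (word_space K n) (word_space K n) _ (alt A) (alt_is_linear A).

Lemma altE A v w : alt A v w = \sum_(s : 'S_n | perm_on A s) (-1) ^+ s * v (wcomp w s).
Proof. by rewrite sum_ffunE; apply: eq_bigr => s _; rewrite ffunE word_actE. Qed.

Lemma perm_onMl A p s : perm_on A p -> perm_on A (p * s)%g = perm_on A s.
Proof.
move=> pA; apply/idP/idP => [psA|]; last exact: perm_onM.
by rewrite -(mulKg p s) perm_onM ?perm_onV.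
Qed.

Lemma perm_onMr A p s : perm_on A p -> perm_on A (s * p)%g = perm_on A s.
Proof.
move=> pA; apply/idP/idP => [psA|sA]; last exact: perm_onM.
by rewrite -(mulgK p s) perm_onM ?perm_onV.
Qed.

Lemma alt_act A p v : perm_on A p -> alt A (word_act p v) = (-1) ^+ p *: alt A v.
Proof.
move=> pA; rewrite /alt scaler_sumr [RHS](reindex_inj (mulgI p)) /=.
apply: eq_big => [s|s _]; first by rewrite perm_onMl.
by rewrite word_actM scalerA odd_permM signr_addb mulrA sgn_mulss mul1r.
Qed.

Lemma act_alt A p v : perm_on A p -> word_act p (alt A v) = (-1) ^+ p *: alt A v.
Proof.
move=> pA; rewrite /alt linear_sum scaler_sumr [RHS](reindex_inj (mulIg p)) /=.
apply: eq_big => [s|s _]; first by rewrite perm_onMr.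
by rewrite linearZ /= word_actM scalerA odd_permM signr_addb mulrCA sgn_mulss mulr1.
Qed.

Lemma perm_on_tperm A x y : x \in A -> y \in A -> perm_on A (tperm x y).
Proof.
move=> xA yA; apply/subsetP=> z; rewrite inE.
by case: tpermP => [->|->|]; rewrite ?eqxx.
Qed.

Lemma oppv_eq0 (U : lmodType K) (v : U) : v = - v -> v = 0.
Proof.
move=> vN; apply/eqP; have : v *+ 2 == 0 by rewrite mulr2n {1}vN addNr.
by rewrite -scaler_nat scaler_eq0 pnatr_eq0.
Qed.

(** The transposition of [x] and [y] fixes the word but changes the sign of [alt A v]. *)
Lemma alt_noninj A v w x y : x \in A -> y \in A -> x != y -> w x = w y -> alt A v w = 0.
Proof.
move=> xA yA nexy wxy; have := act_alt v (perm_on_tperm xA yA).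
move=> /ffunP/(_ w); rewrite word_actE ffunE odd_tperm nexy expr1 /=.
rewrite (_ : wcomp w _ = w); last first.
  by apply/ffunP=> z; rewrite ffunE; case: tpermP => // ->.
by rewrite scaleN1r => /(@oppv_eq0 K^o).
Qed.

Lemma alt_act_noninj A v x y : x \in A -> y \in A -> x != y ->
  word_act (tperm x y) v = v -> alt A v = 0.
Proof.
move=> xA yA nexy vxy; have := alt_act v (perm_on_tperm xA yA).
by rewrite vxy odd_tperm nexy expr1 scaleN1r => /oppv_eq0.
Qed.

(** Sort the permutations by the preimage [y] of [b]: those with a given [y] form the coset of the
    symmetric group of [B :\ y] represented by [tperm y b]. *)
Lemma alt_cosets B v b : b \in B ->
  alt B v = \sum_(y in B)
     (-1) ^+ (tperm y b) *: word_act (tperm y b) (alt (B :\ y) v).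
Proof.
move=> bB; rewrite /alt (partition_big (fun s : 'S_n => (s^-1)%g b) (mem B)) /=; last first.
  by move=> s sB; rewrite perm_closed ?perm_onV.
apply: eq_bigr => y yB; rewrite linear_sum scaler_sumr.
rewrite (reindex_inj (mulIg (tperm y b))) /=; apply: eq_big => [q|q _].
  rewrite perm_onMr ?perm_on_tperm //.
  rewrite (can2_eq (permKV _) (permK _)) permM eq_sym (can2_eq (tpermK _ _) (tpermK _ _)) tpermR.
  apply/andP/idP => [[/subsetP qB /eqP qy]|/subsetP qB].
    by apply/subsetP=> x xq; rewrite !inE qB // andbT; apply: contraTneq xq => ->; rewrite inE qy eqxx.
  split; first by apply/subsetP=> x /qB; rewrite !inE => /andP[].
  by apply: contraT => qy; have := qB y; rewrite !inE eqxx qy => /(_ isT).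
by rewrite linearZ /= word_actM scalerA odd_permM signr_addb mulrC.
Qed.

(** The Garnir-like relation: in the coset expansion at [a], all terms but that of [y = a]
    vanish. *)
Lemma alt_exchange B v a : a \in B -> alt B v = 0 ->
  (forall y, y \in B -> y != a -> alt (B :\ y) v = 0) -> alt (B :\ a) v = 0.
Proof.
move=> aB vB vBy; move: vB; rewrite (alt_cosets v aB) (bigD1 a) //=.
rewrite tperm1 odd_perm1 expr0 scale1r word_act1 big1 ?addr0 //.
by move=> y /andP[yB neya]; rewrite vBy // linear0 scaler0.
Qed.

(* The fixed spaces of the transpositions of a set span the kernel of its
   antisymmetrizer: [v - (-1) ^+ s *: s v] telescopes along a factorization of
   [s] into transpositions. *)
Lemma sub_sgn_act_mem (U : {vspace word_space K n}) A (X : {vspace word_space K n}) :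
  (forall s v, v \in U -> word_act s v \in U) ->
  (forall x y v, x \in A -> y \in A -> x != y -> v \in U ->
     word_act (tperm x y) v = v -> v \in X) ->
  forall s v, perm_on A s -> v \in U -> v - (-1) ^+ s *: word_act s v \in X.
Proof.
move=> actU fixX s v sA vU; have [m] := ubnP #|[set x | s x != x]|.
elim: m s sA => // m IHm s sA; rewrite ltnS => les.
have [s1|[x]] := set_0Vmem [set x | s x != x].
  have -> : s = 1%g.
    apply/permP=> x; rewrite perm1; apply/eqP; apply: contraFT (in_set0 x).
    by rewrite -s1 inE.
  by rewrite odd_perm1 expr0 scale1r word_act1 subrr mem0v.
(* [s'] fixes [x] besides the fixed points of [s], so it moves fewer points. *)
rewrite inE => sx; pose t := tperm x (s x); pose s' := (s * t)%g.
have sE : s = (s' * t)%g by rewrite /s' -mulgA tperm2 mulg1.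
have xA : x \in A by apply: (subsetP sA); rewrite inE.
have sxA : s x \in A by rewrite perm_closed.
have tA : perm_on A t by apply: perm_on_tperm.
have s'A : perm_on A s' by rewrite perm_onM.
have {IHm} := IHm s' s'A => /(_ _) IHs'.
rewrite sE -word_actM odd_permM odd_tperm eq_sym sx addbT signrN scaleNr opprK.
set u := word_act s' v; rewrite -linearZ /=; set u' := (-1) ^+ s' *: u.
have u'U : u' \in U by rewrite memvZ ?actU.
(* The first summand is the claim for [s']; the second is fixed by [t]. *)
have -> : v + word_act t u' = (v - u') + (u' + word_act t u') by rewrite addrA subrK.
apply: memvD.
  apply: IHs'; apply: leq_trans les; apply: proper_card; apply/properP; split.
    apply/subsetP=> y; rewrite !inE permM; apply: contra => /eqP sy.
    rewrite sy; case: tpermP => [yx|yx|//].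
      by rewrite yx in sy *; rewrite sy.
    by rewrite yx in sy *; rewrite (perm_inj sy).
  by exists x; rewrite ?inE // permM tpermR eqxx.
apply: (@fixX x (s x)) => //; first by rewrite eq_sym.
  by rewrite memvD // actU.
by rewrite linearD /= word_actM tperm2 word_act1 addrC.
Qed.

(** Summing [v - (-1) ^+ s *: word_act s v] over the group gives the group order times [v], minus
    [alt A v]; the order is invertible in characteristic 0. *)
Lemma ker_alt_mem (U : {vspace word_space K n}) A (X : {vspace word_space K n}) :
  (forall s v, v \in U -> word_act s v \in U) ->
  (forall x y v, x \in A -> y \in A -> x != y -> v \in U ->
     word_act (tperm x y) v = v -> v \in X) ->
  forall v, v \in U -> alt A v = 0 -> v \in X.
Proof.
move=> actU fixX v vU altv.
have : \sum_(s : 'S_n | perm_on A s) (v - (-1) ^+ s *: word_act s v) \in X.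
  by apply: memv_suml => s sA; apply: sub_sgn_act_mem sA vU.
rewrite sumrB -/(alt A v) altv subr0 sumr_const -scaler_nat rpredZeq pnatr_eq0.
case/orP=> // /eqP c0.
by have /negP[] := negbT (card0_eq c0 1%g); apply: perm_on1.
Qed.

(** Conjugation by [s] carries the column stabilizer of [t] to that of the moved tableau. *)
Lemma act_polytabloid s t :
  word_act s (polytabloid K t) = polytabloid K [ffun x => t ((s^-1)%g x)].
Proof.
rewrite /polytabloid linear_sum [RHS](reindex_inj (conjg_inj s)) /=.
apply: eq_big => [p|p _].
  apply/forallP/forallP => H x.
    by have := H ((s^-1)%g x); rewrite !ffunE conjgE !permM permK.
  by have := H (s x); rewrite !ffunE conjgE !permM !permK.
rewrite linearZ /= odd_permJ word_actM; congr (_ *: _).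
rewrite [X in _ = word_act _ X](_ : _ = word_act s (delta_word K [ffun x => (t x).1])).
  by rewrite word_actM conjgE mulKVg.
apply/ffunP=> w; rewrite word_actE !ffunE; congr (_%:R); congr nat_of_bool.
apply/eqP/eqP => [->|/ffunP E]; apply/ffunP=> x.
  by rewrite !ffunE permK.
by have := E ((s^-1)%g x); rewrite !ffunE permKV.
Qed.

Lemma act_is_tableau mu s t : is_tableau mu t ->
  is_tableau mu [ffun x => t ((s^-1)%g x)] (n := n).
Proof.
case/andP=> /injectiveP injt /forallP tmu; apply/andP; split.
  by apply/injectiveP=> x y; rewrite !ffunE => /injt/perm_inj.
by apply/forallP=> x; rewrite ffunE.
Qed.

Lemma polytabloid_specht mu t : is_tableau mu t -> polytabloid K t \in specht K n mu.
Proof. by move=> tmu; apply: memv_span; apply: image_f. Qed.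

Lemma specht_ind mu (P : word_space K n -> Prop) :
  P 0 -> (forall a u v, P u -> P v -> P (a *: u + v)) ->
  (forall t, is_tableau mu t -> P (polytabloid K t)) ->
  forall v, v \in specht K n mu -> P v.
Proof.
move=> P0 PD Pt v /coord_span->.
elim/big_ind: _ => //; first by move=> u u' Pu Pu'; rewrite -[u]scale1r; apply: PD.
move=> i _; rewrite -[_ *: _]addr0; apply: PD => //.
set b := (X in P X).
have /imageP[t tmu ->] : b \in [seq polytabloid K t | t in is_tableau mu].
  by apply: mem_nth; rewrite size_image.
exact: Pt.
Qed.

Lemma act_specht mu s v : v \in specht K n mu -> word_act s v \in specht K n mu.
Proof.
move: v; apply: specht_ind => [|a u v Wu Wv|t tmu]; first by rewrite linear0 mem0v.
  by rewrite linearP memvD ?memvZ.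
by rewrite act_polytabloid polytabloid_specht // act_is_tableau.
Qed.

Lemma polytabloidE t w : polytabloid K t w =
  \sum_(s : 'S_n | column_stab t s)
     (-1) ^+ s * (wcomp w s == [ffun x => (t x).1])%:R.
Proof. by rewrite sum_ffunE; apply: eq_bigr => s _; rewrite ffunE word_actE ffunE. Qed.

Lemma polytabloid_real t w : polytabloid K t w \is Num.real.
Proof.
rewrite polytabloidE rpred_sum // => s _; rewrite rpredM ?realn //.
by rewrite rpredX // rpredN rpred1.
Qed.

End Action.

(** * Hook shapes and colorings *)

Section HookSpecht.

Variables (K : numFieldType) (n l : nat) (lt_ln : (l < n)%N).
Implicit Types (v : word_space K n) (w : word n) (s p : 'S_n) (A B : {set 'I_n}).
Implicit Types (c : {ffun 'I_n -> 'I_l.+1}) (t : {ffun 'I_n -> 'I_n * 'I_n}).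

Local Notation tableau t := (is_tableau (hook l n) t).
Local Notation W := (specht K n (hook l n)).

Definition column (t : {ffun 'I_n -> 'I_n * 'I_n}) : {set 'I_n} :=
  [set x | (t x).2 == 0%N :> nat].
Definition row_word (t : {ffun 'I_n -> 'I_n * 'I_n}) : word n := [ffun x => (t x).1].

(** Abstracts row words of hook tableaux: rows are numbered up to [l], and each row below the first
    has a single cell. *)
Definition hook_word w :=
  (forall x, (w x <= l)%N) /\ (forall x y, w x = w y -> (0 < w x)%N -> x = y).

Lemma tableau_inj t : tableau t -> injective t.
Proof. by case/andP=> /injectiveP. Qed.

Lemma tableau_row t x : tableau t -> ((t x).1 <= l)%N.
Proof.
case/andP=> _ /forallP/(_ x) lt2; rewrite leqNgt; apply: contraL lt2 => lt_l.
rewrite nth_default ?ltn0 //= size_nseq; lia.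
Qed.

Lemma tableau_col t x : tableau t -> (0 < (t x).1)%N -> (t x).2 = 0%N :> nat.
Proof.
move=> tabt; have := tableau_row x tabt; case/andP: tabt => _ /forallP/(_ x).
by rewrite /hook; case: (nat_of_ord (t x).1) => //= i; rewrite nth_nseq => lt le _; rewrite le in lt; lia.
Qed.

Lemma tableau_row0 t x : tableau t -> (0 < (t x).2)%N -> (t x).1 = 0%N :> nat.
Proof. by move=> tabt; case: (posnP (t x).1) => // /(tableau_col tabt)->. Qed.

Lemma row_word_hook t : tableau t -> hook_word (row_word t).
Proof.
move=> tabt; split=> x; rewrite ?ffunE; first exact: tableau_row.
move=> y; rewrite !ffunE => exy x_gt0; apply: (tableau_inj tabt).
rewrite [t x]surjective_pairing [t y]surjective_pairing exy; congr (_, _).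
by apply: val_inj; rewrite /= !(tableau_col tabt) // -exy.
Qed.

Lemma row_word_inj t : tableau t -> {in column t &, injective (row_word t)}.
Proof.
move=> tabt x y; rewrite !inE !ffunE => /eqP x0 /eqP y0 exy.
apply: (tableau_inj tabt); rewrite [t x]surjective_pairing [t y]surjective_pairing exy.
by congr (_, _); apply: val_inj; rewrite /= x0.
Qed.

(** Every column but the first has a single cell, so a column-preserving permutation moves only
    points of the first column. *)
Lemma column_stabE t s : tableau t -> column_stab t s = perm_on (column t) s.
Proof.
move=> tabt; apply/forallP/idP => [stab|sA x]; last first.
  have [xA|xA] := boolP (x \in column t); last by rewrite (out_perm sA).
  have : s x \in column t by rewrite perm_closed.
  by move: xA; rewrite !inE -val_eqE /= => /eqP-> /eqP->.
apply/subsetP=> x; rewrite !inE; apply: contraR => x0.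
have /eqP e2 := stab x; apply/eqP; apply: (tableau_inj tabt).
rewrite [t x]surjective_pairing [LHS]surjective_pairing e2; congr (_, _).
by apply: val_inj; rewrite /= !(tableau_row0 tabt) ?e2 // lt0n.
Qed.

(** Row indices inject the column into [l.+1] values, and column indices inject its complement into
    [n - l.+1] nonzero values; the two bounds add up to [n]. *)
Lemma card_column t : tableau t -> #|column t| = l.+1.
Proof.
move=> tabt; have leA : (#|column t| <= l.+1)%N.
  rewrite -[X in (_ <= X)%N]card_ord.
  rewrite -(@card_in_imset _ _ (fun x => inord (row_word t x) : 'I_l.+1)) ?max_card //.
  move=> x y xA yA /(congr1 val) /=; rewrite !inordK ?ltnS; last 2 first.
  - by rewrite ffunE tableau_row.
  - by rewrite ffunE tableau_row.
  by move=> /val_inj; apply: row_word_inj.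
have n_l : (n - l)%N = (n - l).-1.+1 by lia.
have lt2 x : ((t x).2 < (n - l).-1.+1)%N.
  have := tableau_row0 (x := x) tabt; case/andP: (tabt) => _ /forallP/(_ x).
  rewrite -n_l /hook; case: (posnP (t x).2) => [->|_ lt /(_ isT) t0]; first by lia.
  by move: lt; rewrite t0.
have leCA : (#|~: column t| <= n - l.+1)%N.
  rewrite -(@card_in_imset _ _ (fun x => Ordinal (lt2 x))); last first.
    move=> x y; rewrite !inE -!lt0n => x0 y0 [] e2; apply: (tableau_inj tabt).
    rewrite [t x]surjective_pairing [t y]surjective_pairing; congr (_, _); apply: val_inj => //=.
    by rewrite !(tableau_row0 tabt).
  have -> : (n - l.+1 = #|[set~ (@ord0 (n - l).-1)]|)%N.
    by rewrite cardsC1 card_ord; lia.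
  rewrite subset_leq_card //; apply/subsetP=> _ /imsetP[x xA ->].
  by move: xA; rewrite !inE -val_eqE.
by have := cardsC (column t); rewrite card_ord; lia.
Qed.

Lemma hook_word_comp w s : hook_word (wcomp w s) -> hook_word w.
Proof.
case=> le_l inj_w; split=> [x|x y exy x_gt0].
  by have := le_l ((s^-1)%g x); rewrite ffunE permKV.
have := inj_w ((s^-1)%g x) ((s^-1)%g y); rewrite !ffunE !permKV => /(_ exy x_gt0).
exact: perm_inj.
Qed.

Lemma specht_supp v w : v \in W -> v w != 0 -> hook_word w.
Proof.
move=> vW; move: v vW w; apply: specht_ind => [w|a u v Pu Pv w|t tabt w].
- by rewrite ffunE eqxx.
- rewrite ffunE ffunE; have [->|/Pu//] := eqVneq (u w) 0.
  by rewrite scaler0 add0r => /Pv.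
rewrite polytabloidE; have [s|none] := pickP (fun s => column_stab t s && (wcomp w s == row_word t)).
  by case/andP=> _ /eqP ws _; apply: (@hook_word_comp _ s); rewrite ws; apply: row_word_hook.
rewrite big1 ?eqxx // => s stab; have := none s; rewrite stab /= => ->.
by rewrite mulr0.
Qed.

Lemma hook_word_onto w A i : hook_word w -> #|A| = l.+1 -> {in A &, injective w} ->
  (i <= l)%N -> exists2 x, x \in A & w x = i :> nat.
Proof.
case=> le_l _ cA injw le_il.
pose f x : 'I_l.+1 := inord (w x).
have fE x : f x = w x :> nat by rewrite inordK // ltnS.
have : inord i \in f @: A.
  suff -> : f @: A = setT by [].
  apply/eqP; rewrite eqEcard subsetT cardsT card_ord card_in_imset ?cA //=.
  by move=> x y xA yA /(congr1 val); rewrite /= !fE => /val_inj; apply: injw.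
by case/imsetP=> x xA e; exists x => //; rewrite -fE -e inordK.
Qed.

Lemma hook_word_out w A x : hook_word w -> #|A| = l.+1 -> {in A &, injective w} ->
  x \notin A -> w x = 0%N :> nat.
Proof.
move=> hw cA injw xA; case: (posnP (w x)) => // x_gt0; case: (hw) => le_l inj0.
have [y yA e] := hook_word_onto hw cA injw (le_l x).
have exy : x = y by apply: inj0 => //; apply: val_inj; rewrite /= e.
by rewrite exy yA in xA.
Qed.

(** One value determines [alt A v]: it vanishes except at hook words injective on [A], and these
    differ from [w0] by a permutation of [A] because they are 0 outside [A]. *)
Lemma alt_eq0 A v w0 : v \in W -> #|A| = l.+1 -> hook_word w0 ->
  {in A &, injective w0} -> alt A v w0 = 0 -> alt A v = 0.
Proof.
move=> vW cA hw0 injw0 v0; apply/ffunP=> w; rewrite [RHS]ffunE.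
have [//|nz] := eqVneq (alt A v w) 0; exfalso; move: nz.
have [s|none] := pickP (fun s => v (wcomp w s) != 0); last first.
  rewrite altE big1 ?eqxx // => s _; have := none s => /negbFE/eqP->.
  by rewrite mulr0.
move=> /(specht_supp vW)/hook_word_comp hw.
have [|injw] := boolP [exists x in A, exists y in A, (x != y) && (w x == w y)].
  case/exists_inP=> x xA /exists_inP[y yA /andP[nexy /eqP exy]].
  by rewrite (alt_noninj v xA yA nexy exy) eqxx.
have {}injw : {in A &, injective w}.
  move=> x y xA yA exy; apply/eqP; apply: contraNT injw => nexy.
  by apply/exists_inP; exists x => //; apply/exists_inP; exists y; rewrite // nexy exy eqxx.
(* [f] will be the permutation of [A] that matches the letters of [w] with those of [w0]. *)
have ex x : exists y, if x \in A then (y \in A) && (w0 y == w x) else y == x.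
  have [xA|xA] := boolP (x \in A); last by exists x.
  have [y yA e] := hook_word_onto hw0 cA injw0 (hw.1 x).
  by exists y; rewrite yA -val_eqE /= e eqxx.
have /fin_all_exists[f Hf] := ex.
have fA x : x \in A -> f x \in A /\ w0 (f x) = w x.
  by move=> xA; have := Hf x; rewrite xA => /andP[-> /eqP].
have fC x : x \notin A -> f x = x.
  by move=> xA; have := Hf x; rewrite (negPf xA) => /eqP.
have injf : injective f.
  move=> x y; have [xA|xA] := boolP (x \in A); have [yA|yA] := boolP (y \in A).
  - by move=> exy; apply: injw => //; rewrite -(fA x xA).2 -(fA y yA).2 exy.
  - by rewrite (fC y) // => exy; rewrite -exy (fA x xA).1 in yA.
  - by rewrite (fC x) // => exy; rewrite exy (fA y yA).1 in xA.
  - by rewrite !fC.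
have fon : perm_on A (perm injf).
  by apply/subsetP=> x; rewrite inE permE; apply: contraR => /fC->.
have <- : wcomp w0 (perm injf) = w.
  apply/ffunP=> x; rewrite ffunE permE; have [/fA[]//|xA] := boolP (x \in A).
  by rewrite fC //; apply: val_inj; rewrite /= (hook_word_out hw0 cA) // (hook_word_out hw cA).
by rewrite -word_actE act_alt // ffunE v0 scaler0 eqxx.
Qed.

(** With only [l.+1] letters, every hook word repeats one on [B]. *)
Lemma alt_large B v : v \in W -> #|B| = l.+2 -> alt B v = 0.
Proof.
move=> vW cB; apply/ffunP=> w; rewrite [RHS]ffunE.
have [hw|nhw] := boolP [forall x, w x <= l]%N; last first.
  rewrite altE big1 // => s _; apply/eqP; rewrite mulf_eq0 signr_eq0 /=.
  apply: contraR nhw => /(specht_supp vW)/hook_word_comp[le_l _].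
  by apply/forallP.
pose f x : 'I_l.+1 := inord (w x).
have fE x : f x = w x :> nat by rewrite inordK // ltnS (forallP hw).
have /dinjectivePn[x xB [y /andP[neyx yB] e]] : ~~ dinjectiveb f B.
  apply/negP => /dinjectiveP injf.
  have := max_card (mem (f @: B)); rewrite card_in_imset // cB card_ord; lia.
apply: alt_noninj xB yB _ _; first by rewrite eq_sym.
by apply: val_inj; rewrite /= -!fE e.
Qed.

(* The color classes of [c] play the role of the blocks of a set partition into
   [l.+1] parts; the sets [A] that are not rainbow form a coatom. *)
Definition rainbow c A := (#|A| == l.+1) && (#|c @: A| == l.+1).

Lemma rainbowP c A : #|A| = l.+1 ->
  reflect {in A &, injective c} (rainbow c A).
Proof.
move=> cA; have -> : rainbow c A = (#|c @: A| == #|A|) by rewrite /rainbow cA eqxx.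
exact: imset_injP.
Qed.

Lemma rainbow_onto c A i : rainbow c A -> exists2 x, x \in A & c x = i.
Proof.
case/andP=> _ /eqP cAT; suff /imsetP[x xA ->] : i \in c @: A by exists x.
have -> // : c @: A = setT.
by apply/eqP; rewrite eqEcard subsetT cardsT card_ord cAT /=.
Qed.

(** Move [A] towards [A'] one point at a time: [b] in [A'] replaces the point [a] of [A] with its
    color. In [B = b |: A], removing [b] gives [A], and removing any point other than [a] and [b]
    leaves two points of one color, so the exchange relation applies to [B :\ a]. *)
Lemma rainbow_transfer c v A A' : v \in W ->
  (forall B, #|B| = l.+1 -> ~~ rainbow c B -> alt B v = 0) ->
  rainbow c A -> rainbow c A' -> alt A v = 0 -> alt A' v = 0.
Proof.
move=> vW Dv; have [m] := ubnP #|A' :\: A|; elim: m A => // m IHm A.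
rewrite ltnS => leA rA rA' vA.
have [/eqP cA _] := andP rA; have [/eqP cA' _] := andP rA'.
have /(rainbowP _ cA) injA := rA; have /(rainbowP _ cA') injA' := rA'.
have [A'A0|[b]] := set_0Vmem (A' :\: A).
  suff -> : A' = A by [].
  by apply/eqP; rewrite eqEcard cA cA' leqnn andbT -setD_eq0 A'A0.
rewrite inE => /andP[bA bA'].
have [a aA cab] := rainbow_onto (c b) rA.
have aA' : a \notin A'.
  apply: contra bA => aA'; suff <- : a = b by [].
  exact: injA'.
have neab : a != b by apply: contraNneq bA => <-.
pose B := b |: A; have cB : #|B| = l.+2 by rewrite cardsU1 bA cA.
have aB : a \in B by rewrite !inE aA orbT.
have cBy y : y \in B -> #|B :\ y| = l.+1 by move=> yB; rewrite (cardsD1 y) yB in cB; case: cB.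
have vBa : alt (B :\ a) v = 0.
  apply: alt_exchange aB (alt_large vW cB) _ => y yB neya.
  have [->|neyb] := eqVneq y b; first by rewrite setU1K.
  apply: Dv; rewrite ?cBy //; apply/negP => /(rainbowP _ (cBy y yB)) injc.
  case/eqP: neab; apply: injc => //; rewrite !inE ?eqxx ?aA ?orbT andbT.
    by rewrite eq_sym.
  by rewrite eq_sym.
apply: (IHm (B :\ a)) => //; last first.
  apply/rainbowP; rewrite ?cBy // => x y; rewrite !inE.
  case/andP=> nexa /predU1P[->|xA] /andP[neya /predU1P[->|yA]] // exy.
  - by case/eqP: neya; apply: injA => //; rewrite cab.
  - by case/eqP: nexa; apply: injA => //; rewrite cab.
  - exact: injA.
apply: leq_trans leA; apply: proper_card; apply/properP; split.
  apply/subsetP=> x; rewrite !inE negb_and negbK negb_or => /andP[/predU1P[->|/andP[_ ->]//] xA'].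
  by rewrite xA' in aA'.
by exists b; rewrite !inE ?bA // eqxx /= eq_sym neab.
Qed.

Lemma tableau_of_set c A : rainbow c A ->
  exists t, [/\ tableau t, column t = A & forall x, x \in A -> row_word t x = c x :> nat].
Proof.
case/andP=> /eqP cA /eqP cAT.
have injc : {in A &, injective c} by apply/imset_injP; rewrite cAT cA.
have n0 : (0 < n)%N by apply: leq_ltn_trans lt_ln.
pose i0 : 'I_n := Ordinal n0.
have lt_idx x : x \notin A -> ((index x (enum (~: A))).+1 < n - l)%N.
  move=> xA; have : (index x (enum (~: A)) < #|~: A|)%N.
    by rewrite cardE index_mem mem_enum inE.
  have := cardsC A; rewrite cA card_ord; lia.
pose idx x : 'I_n := insubd i0 (index x (enum (~: A))).+1.
have idxE x : x \notin A -> idx x = (index x (enum (~: A))).+1 :> nat.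
  by move=> xA; rewrite /idx val_insubd ifT //; have := lt_idx x xA; lia.
(* The points outside [A] fill the first row in order, shifted by 1 past the corner cell. *)
pose t := [ffun x => if x \in A then (widen_ord lt_ln (c x), i0) else (i0, idx x)].
exists t; split.
- apply/andP; split.
    apply/injectiveP=> x y; rewrite !ffunE.
    case: ifPn => xA; case: ifPn => yA exy.
    + by apply: injc => //; apply: val_inj; have [] := exy.
    + by have := idxE y yA; rewrite -[idx y]/((i0, idx y).2) -exy.
    + by have := idxE x xA; rewrite -[idx x]/((i0, idx x).2) exy.
    + have := idxE x xA; rewrite -[idx x]/((i0, idx x).2) exy /= idxE // => -[].
      by move/(congr1 (nth x (enum (~: A)))); rewrite !nth_index ?mem_enum ?inE.
  apply/forallP=> x; rewrite ffunE; case: ifPn => xA /=; last by rewrite idxE // lt_idx.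
  rewrite /hook; case: (c x) => -[|i] /= lti; first by lia.
  by rewrite nth_nseq ifT //; lia.
- by apply/setP=> x; rewrite inE ffunE; case: ifPn => xA //=; rewrite idxE.
- by move=> x xA; rewrite !ffunE xA.
Qed.

(** * The invariant vector of a coloring *)

Definition dot (u v : word_space K n) : K := \sum_w (u w : K) * v w.

(** The column antisymmetrizer is its own adjoint for [dot], since inversion preserves the group and
    the signs. *)
Lemma dot_polytabloid t v : tableau t ->
  dot (polytabloid K t) v = alt (column t) v (row_word t).
Proof.
move=> tabt; rewrite altE [RHS](reindex_inj invg_inj) /= /dot.
under [LHS]eq_bigr => w _ do rewrite polytabloidE mulr_suml.
rewrite exchange_big /=; apply: eq_big => [s|s _].
  by rewrite column_stabE // -{1}[s]invgK; apply/idP/idP; [move/perm_onV; rewrite invgK|exact: perm_onV].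
rewrite (bigD1 (wcomp (row_word t) (s^-1)%g)) //= odd_permV.
rewrite [X in (nat_of_bool X)%:R](_ : _ = true) ?mulr1; last first.
  by apply/eqP/ffunP=> x; rewrite !ffunE permK.
rewrite big1 ?addr0 // => w new; rewrite [X in (nat_of_bool X)%:R](_ : _ = false) ?mulr0 ?mul0r //.
apply: contraNF new => /eqP ws; apply/eqP/ffunP=> x.
by rewrite ffunE -[row_word t]ws ffunE permKV.
Qed.

Definition adapted c t := tableau t && [forall x in column t, row_word t x == c x :> nat].

(** All orders of the first row are included, so that every color-preserving permutation permutes
    the summands. *)
Definition psi c : word_space K n := \sum_(t | adapted c t) polytabloid K t.

Lemma psi_specht c : psi c \in W.
Proof. by apply: memv_suml => t /andP[tabt _]; apply: polytabloid_specht. Qed.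

Lemma act_psi c s : (forall x, c (s x) = c x) -> word_act s (psi c) = psi c.
Proof.
move=> cs; rewrite /psi linear_sum /=.
pose h (p : 'S_n) (t : {ffun 'I_n -> 'I_n * 'I_n}) := [ffun x => t (p x)].
have hK p : cancel (h p) (h (p^-1)%g) by move=> t; apply/ffunP=> x; rewrite !ffunE permKV.
rewrite [RHS](reindex_inj (can_inj (hK (s^-1)%g))) /=; apply: eq_big => [t|t _]; last first.
  by rewrite act_polytabloid.
have adapted_h p t' : (forall x, c (p x) = c x) -> adapted c t' -> adapted c (h (p^-1)%g t').
  move=> cp /andP[tabt /forall_inP rc]; rewrite /adapted act_is_tableau //=.
  apply/forall_inP=> x; rewrite inE ffunE => xt; rewrite !ffunE -(permKV p x) cp permK.
  by have := rc ((p^-1)%g x); rewrite inE xt ffunE => ->.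
apply/idP/idP => [|gt]; first exact: adapted_h.
rewrite -[t](hK (s^-1)%g); apply: adapted_h gt => x.
by rewrite -{2}(permKV s x) cs.
Qed.

Lemma alt_psi_nonrainbow c A : #|A| = l.+1 -> ~~ rainbow c A -> alt A (psi c) = 0.
Proof.
move=> cA; rewrite /rainbow cA eqxx /= => nr.
have /dinjectivePn[x xA [y /andP[neyx yA] e]] : ~~ dinjectiveb c A.
  by apply: contra nr => /dinjectiveP injc; rewrite card_in_imset ?cA.
apply: (alt_act_noninj xA yA); first by rewrite eq_sym.
by apply: act_psi => z; case: tpermP => [->|->|].
Qed.

Lemma psi_real c w : psi c w \is Num.real.
Proof. by rewrite sum_ffunE rpred_sum // => t _; apply: polytabloid_real. Qed.

(** At the row word of one adapted tableau every summand takes the value 0 or 1, so nothing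
    cancels. *)
Lemma psi_neq0 c A : rainbow c A -> exists w, psi c w != 0.
Proof.
move=> rA; have [t0 [tabt0 ct0 rt0]] := tableau_of_set rA.
pose w0 := row_word t0.
have w0E x : (0 < w0 x)%N -> w0 x = c x :> nat.
  move=> x_gt0; apply: rt0; rewrite -ct0 inE; apply/eqP.
  by apply: (tableau_col tabt0); move: x_gt0; rewrite ffunE.
have ptE t : adapted c t -> polytabloid K t w0 = (w0 == row_word t)%:R.
  case/andP=> tabt /forall_inP rc.
  have rcE x : x \in column t -> row_word t x = c x :> nat by move=> /rc/eqP.
  have injc : {in column t &, injective c}.
    move=> x y xA yA exy; apply: (row_word_inj tabt) => //.
    by apply: val_inj; rewrite /= !rcE // exy.
  rewrite polytabloidE (bigD1 1%g) /=; last by rewrite column_stabE // perm_on1.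
  rewrite odd_perm1 mul1r (_ : wcomp w0 1 = w0); last by apply/ffunP=> x; rewrite ffunE perm1.
  rewrite big1 ?addr0 // => s /andP[]; rewrite column_stabE // => sA s1.
  rewrite [X in (nat_of_bool X)%:R](_ : _ = false) ?mulr0 //; apply: contraNF s1 => /eqP/ffunP ws.
  (* A permutation contributing to this value preserves positive colors in the column, hence fixes
     the points that carry them; the one remaining point is then fixed too. *)
  have fixs x : x \in column t -> (0 < c x)%N -> s x = x.
    move=> xA x_gt0; have := ws x; rewrite ffunE => /(congr1 val) /=.
    rewrite -[[ffun _ => _]]/(row_word t) rcE // => e; apply: injc; rewrite ?perm_closed //.
    by apply: val_inj; rewrite /= -w0E e.
  apply/eqP/permP=> x; rewrite perm1; have [xA|xA] := boolP (x \in column t); last by rewrite (out_perm sA).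
  have sxA : s x \in column t by rewrite perm_closed.
  have [cx0|/fixs->//] := posnP (c x).
  have [csx0|/(fixs _ sxA)/perm_inj->//] := posnP (c (s x)).
  by apply: injc => //; apply: val_inj; rewrite /= cx0.
exists w0; rewrite sum_ffunE (eq_bigr (fun t => (w0 == row_word t)%:R)); last by move=> t /ptE.
rewrite (bigD1 t0) /=; last first.
  by rewrite /adapted tabt0; apply/forall_inP=> x; rewrite ct0 => /rt0/eqP.
rewrite eqxx gt_eqF // ltr_pwDl ?ltr01 //; apply: sumr_ge0 => t _; exact: ler0n.
Qed.

(** If one rainbow antisymmetrizer killed [psi c], transfer would make all of them do so; then
    [psi c] would be orthogonal to its own summands, hence to itself. *)
Lemma alt_psi_rainbow c A : rainbow c A -> alt A (psi c) != 0.
Proof.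
move=> rA; apply/eqP => psiA.
have psi0 B : #|B| = l.+1 -> alt B (psi c) = 0.
  move=> cB; have [rB|] := boolP (rainbow c B); last exact: alt_psi_nonrainbow.
  exact: rainbow_transfer (psi_specht c) (@alt_psi_nonrainbow c) rA rB psiA.
have dot0 : dot (psi c) (psi c) = 0.
  transitivity (\sum_(t | adapted c t) dot (polytabloid K t) (psi c)).
    rewrite /dot exchange_big; apply: eq_bigr => w _.
    by rewrite -mulr_suml {1}/psi sum_ffunE.
  apply: big1 => t /andP[tabt _].
  by rewrite dot_polytabloid // psi0 ?card_column // ffunE.
have [w /negP] := psi_neq0 rA; apply.
(* [dot] involves no conjugation; squares are nonnegative because the values of [psi c] are real. *)
have sq_ge0 u : true -> 0 <= (psi c u : K) * psi c u.
  by move=> _; rewrite -expr2 real_exprn_even_ge0 // psi_real.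
by have /eqP := @psumr_eq0P _ _ _ _ sq_ge0 dot0 w isT; rewrite mulf_eq0 orbb.
Qed.

End HookSpecht.

(** * Coatoms of the intrinsic arrangement *)

Section HookArrangement.

Variables (K : numFieldType) (n l : nat) (l_gt0 : (0 < l)%N) (lt_ln : (l < n)%N).
Implicit Types (v : word_space K n) (A B : {set 'I_n}).
Implicit Types (c : {ffun 'I_n -> 'I_l.+1}).

Local Notation W := (specht K n (hook l n)).
Local Notation arr := (intrinsic_arr K n (hook l n)).
Local Notation ground := (arr_ground arr).

Lemma conj_hook : conj_part (hook l n) = l.+1 :: nseq (n - l).-1 1%N.
Proof.
rewrite /conj_part /=; have -> : (n - l = (n - l).-1.+1)%N by lia.
rewrite /= count_nseq mul1n; congr (_ :: _).
apply: (@eq_from_nth _ 0%N) => [|i]; first by rewrite size_map size_iota size_nseq.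
rewrite size_map size_iota => lti.
rewrite (nth_map 0%N) ?size_iota // nth_nseq lti nth_iota // count_nseq /=.
by rewrite (_ : (1 + i < _)%N = true) //; lia.
Qed.

(** As [l > 0], exactly one block is not a singleton. The hyperplane depends only on which pairs
    share a block, hence the form of the conclusion. *)
Lemma set_partition_block (alpha : {set {set 'I_n}}) :
  alpha \in set_partitions_of_type n (conj_part (hook l n)) ->
  exists2 A : {set 'I_n}, #|A| = l.+1 &
    forall x y, x != y ->
      [exists B in alpha, (x \in B) && (y \in B)] = (x \in A) && (y \in A).
Proof.
rewrite inE conj_hook => /andP[_ perm_sizes].
have : l.+1 \in [seq #|B| | B : {set 'I_n} <- enum alpha].
  by rewrite (perm_mem perm_sizes) mem_head.
case/mapP=> A; rewrite mem_enum => Aalpha cA; exists A => // x y nexy.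
apply/exists_inP/andP => [[B Balpha /andP[xB yB]]|[xA yA]]; last by exists A; rewrite // xA.
suff <- : B = A by [].
have cB : #|B| != 1%N.
  by apply/negP => /cards1P[z eB]; move: xB yB nexy; rewrite eB !inE => /eqP-> /eqP->; rewrite eqxx.
have le1 : (#|[set B in alpha | #|B| != 1%N]| <= 1)%N.
  rewrite cardE -(size_map (fun B : {set 'I_n} => #|B|)).
  have -> : size [seq #|B| | B : {set 'I_n} <- enum [set B in alpha | #|B| != 1%N]] =
            count (fun m => m != 1%N) [seq #|B| | B : {set 'I_n} <- enum alpha].
    rewrite size_map -cardE count_map -size_filter cardE; apply: perm_size.
    apply: uniq_perm => [||C]; [exact: enum_uniq|exact/filter_uniq/enum_uniq|].
    by rewrite mem_enum inE [RHS]mem_filter mem_enum andbC.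
  by rewrite (seq.permP perm_sizes) /= count_nseq /= mul0n; case: eqP.
apply: (card_le1_eqP le1); rewrite inE ?Balpha ?Aalpha //=.
by rewrite -cA; lia.
Qed.

Lemma block_set_partition A : #|A| = l.+1 ->
  exists2 alpha : {set {set 'I_n}}, alpha \in set_partitions_of_type n (conj_part (hook l n)) &
    forall x y, x != y ->
      [exists B in alpha, (x \in B) && (y \in B)] = (x \in A) && (y \in A).
Proof.
move=> cA; pose alpha := A |: [set [set x] | x in ~: A].
have A0 : A != set0 by rewrite -card_gt0 cA.
have memA x B : B \in alpha -> x \in B -> B = if x \in A then A else [set x].
  case/setU1P=> [-> ->//|/imsetP[y yA ->] /set1P->].
  by move: yA; rewrite inE => /negPf->.
have mem_alpha x : (if x \in A then A else [set x]) \in alpha.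
  case: ifPn => xA; first exact: setU11.
  by apply/setU1P; right; apply: imset_f; rewrite inE.
exists alpha => [|x y nexy]; last first.
  apply/exists_inP/andP => [[B Ba /andP[xB yB]]|[xA yA]]; last first.
    by exists A; rewrite ?setU11 // xA.
  have := memA x B Ba xB; case: ifPn => [xA eB|_ eB]; first by rewrite -eB yB.
  by move: yB nexy; rewrite eB inE eq_sym => ->.
rewrite inE; apply/andP; split.
  apply/and3P; split.
  - rewrite eqEsubset subsetT /=; apply/subsetP=> x _; apply/bigcupP.
    by exists (if x \in A then A else [set x]) => //; case: ifP => //; rewrite inE.
  - apply/trivIsetP=> B C Ba Ca; apply: contraR => /pred0Pn[x /andP[xB xC]].
    by rewrite (memA x B) // (memA x C).
  - apply/negP => /setU1P[e|/imsetP[y _ /setP/(_ y)]]; first by rewrite -e eqxx in A0.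
    by rewrite !inE eqxx.
rewrite conj_hook.
have enumE : perm_eq (enum alpha) (A :: [seq [set x] | x <- enum (~: A)]).
  apply: uniq_perm; rewrite ?enum_uniq //=.
    rewrite (map_inj_uniq set1_inj) enum_uniq andbT; apply/negP => /mapP[x].
    rewrite mem_enum inE => xA e; move/setP/(_ x): e.
    by rewrite (negPf xA) inE eqxx.
  move=> B; rewrite mem_enum !inE; congr (_ || _).
  by apply/imsetP/mapP => -[x xA ->]; exists x => //; move: xA; rewrite mem_enum.
apply: perm_trans (perm_map _ enumE) _; rewrite /= cA.
suff -> : [seq (#|(B : {set 'I_n})| ) | B <- [seq [set x] | x <- enum (~: A)]] = nseq (n - l).-1 1%N by [].
apply: (@eq_from_nth _ 0%N) => [|i].
  by rewrite !size_map size_nseq -cardE; have := cardsC A; rewrite cA card_ord; lia.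
rewrite size_map => lti; rewrite (nth_map set0) // nth_nseq.
have /mapP[x _ ->] := mem_nth set0 lti.
rewrite cards1 ifT //; move: lti; rewrite size_map -cardE.
by have := cardsC A; rewrite cA card_ord; lia.
Qed.

(** Vectors fixed by a transposition of [A] are killed by [alt A], and conversely [ker_alt_mem]
    writes the kernel as a sum of such fixed spaces. *)
Lemma mem_intrinsic_hyp (alpha : {set {set 'I_n}}) A v :
  (forall x y, x != y ->
      [exists B in alpha, (x \in B) && (y \in B)] = (x \in A) && (y \in A)) ->
  (v \in intrinsic_hyp K (hook l n) alpha) = (v \in W) && (alt A v == 0).
Proof.
move=> blockA; apply/idP/andP => [|[vW /eqP altv]].
  have sub : (intrinsic_hyp K (hook l n) alpha <= W :&: lker (linfun (alt A)))%VS.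
    apply/subv_sumP=> -[x y] /andP[/= nexy]; rewrite blockA // => /andP[xA yA].
    apply/subvP=> u; rewrite !memv_cap => /andP[-> /fixedSpaceP].
    rewrite lfunE /= => uxy.
    by rewrite memv_ker lfunE /= (alt_act_noninj xA yA nexy uxy).
  move/(subvP sub); rewrite memv_cap memv_ker lfunE /= => /andP[-> ->]; by [].
apply: (@ker_alt_mem K n W A) vW altv => [s u|x y u xA yA nexy uW uxy].
  exact: act_specht.
apply: (subvP (sumv_sup (x, y) _ (subvv _))); first by rewrite /= nexy blockA // xA.
by rewrite memv_cap uW; apply/fixedSpaceP; rewrite lfunE.
Qed.

Definition cut_by (H : ground) A : Prop :=
  forall v, (v \in ssval H) = (v \in W) && (alt A v == 0).

Lemma ground_cut (H : ground) : exists2 A : {set 'I_n}, #|A| = l.+1 & cut_by H A.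
Proof.
have /mapP[alpha] := ssvalP H; rewrite mem_enum => /set_partition_block[A cA blockA] eH.
by exists A => // v; rewrite eH (mem_intrinsic_hyp _ blockA).
Qed.

Lemma cut_ground A : #|A| = l.+1 -> exists H : ground, cut_by H A.
Proof.
case/block_set_partition=> alpha alphaP blockA.
have Hin : intrinsic_hyp K (hook l n) alpha \in arr_hyps arr.
  by apply: map_f; rewrite mem_enum.
by exists (SeqSub Hin) => v; rewrite (mem_intrinsic_hyp _ blockA).
Qed.

Lemma card_ground : (#|ground| <= 'C(n, l.+1))%N.
Proof.
have ex H : exists A : {set 'I_n}, #|A| = l.+1 /\ cut_by H A by have [A] := ground_cut H; exists A.
have /fin_all_exists[f Hf] := ex.
rewrite -[in 'C(n, _)](card_ord n) -card_draws -(@card_imset _ _ f) => [|H H' eH].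
  by apply/subset_leq_card/subsetP=> _ /imsetP[H _ ->]; rewrite inE (Hf H).1.
by apply: val_inj; apply/vspaceP=> v; rewrite (Hf H).2 (Hf H').2 eH.
Qed.

Definition color_flat c : {set ground} := [set H : ground | psi K c \in ssval H].

Lemma mem_color_flat c H A : #|A| = l.+1 -> cut_by H A ->
  (H \in color_flat c) = ~~ rainbow c A.
Proof.
move=> cA HA; rewrite inE HA psi_specht /=.
have [rA|nrA] := boolP (rainbow c A); last by rewrite alt_psi_nonrainbow // eqxx.
exact/negbTE/alt_psi_rainbow.
Qed.

(** Subtract from a vector in the core the multiple of [psi] that makes [alt A] vanish at one word.
    Then [alt A] kills the difference by [alt_eq0], and transfer puts it in every hyperplane. *)
Lemma color_flat_coatom c A : rainbow c A ->
  flat (@arr_rank K _ arr) (color_flat c) &&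
  ((arr_rank (color_flat c)).+1 == arr_rank [set: ground]).
Proof.
move=> rA; have /andP[/eqP cA _] := rA.
have psiA := alt_psi_rainbow K lt_ln rA.
apply: arr_coatom; first exact: psi_specht.
  apply/negP => /memv_core[_ psiT]; have [H HA] := cut_ground cA.
  by move: (psiT H (in_setT H)); rewrite HA (negPf psiA) andbF.
have [t [tabt ct rt]] := tableau_of_set lt_ln rA.
have hw := row_word_hook lt_ln tabt; have injw := row_word_inj tabt.
rewrite ct in injw; set w := row_word t in hw injw *.
have psiw : alt A (psi K c) w != 0.
  by apply: contra psiA => /eqP/(alt_eq0 lt_ln (psi_specht _ _) cA hw injw)->.
apply/subvP=> v /memv_core[vW vF]; pose a := alt A v w / alt A (psi K c) w.
rewrite -(subrK (a *: psi K c) v); apply: memv_add; last by rewrite memvZ ?memv_line.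
have uW : v - a *: psi K c \in W by rewrite rpredB ?rpredZ ?psi_specht.
have Du B : #|B| = l.+1 -> ~~ rainbow c B -> alt B (v - a *: psi K c) = 0.
  move=> cB nrB; have [H HB] := cut_ground cB.
  have := vF H; rewrite (mem_color_flat c cB HB) => /(_ nrB); rewrite HB => /andP[_ /eqP vB].
  by rewrite linearB linearZ /= vB alt_psi_nonrainbow // scaler0 subrr.
have uA : alt A (v - a *: psi K c) = 0.
  apply: (alt_eq0 lt_ln uW cA hw injw); rewrite linearB linearZ /= !ffunE.
  by rewrite /a [_ *: _]divfK ?subrr.
apply/memv_core; split=> // H _; have [B cB HB] := ground_cut H.
rewrite HB uW; have [rB|nrB] := boolP (rainbow c B); last by rewrite Du ?eqxx.
by rewrite (rainbow_transfer lt_ln uW Du rA rB uA) eqxx.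
Qed.

(** * Counting the coatoms that come from colorings *)

Definition surjb c := (c @: setT) == setT.

Lemma surj_rainbow c (x y : 'I_n) : surjb c -> c x != c y ->
  exists A, [/\ rainbow c A, x \in A & y \in A].
Proof.
move=> /eqP surjc necxy.
have ex (i : 'I_l.+1) : exists z, c z == i.
  by have : i \in c @: setT by [rewrite surjc inE]; case/imsetP=> z _ ->; exists z.
have /fin_all_exists[r Hr] := ex.
pose rep i := if i == c x then x else if i == c y then y else r i.
have repK : cancel rep c.
  by move=> i; rewrite /rep; case: eqP => // _; case: eqP => // _; apply/eqP.
have crep : #|rep @: setT| = l.+1 by rewrite card_imset ?cardsT ?card_ord //; apply: can_inj repK.
exists (rep @: setT); split.
- apply/rainbowP => // _ _ /imsetP[i _ ->] /imsetP[j _ ->].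
  by rewrite !repK => ->.
- by apply/imsetP; exists (c x); rewrite // /rep eqxx.
- by apply/imsetP; exists (c y); rewrite // /rep eqxx eq_sym (negPf necxy).
Qed.

Lemma surj_has_rainbow c : surjb c -> exists A, rainbow c A.
Proof.
move=> surjc; have n0 : (0 < n)%N := leq_ltn_trans (leq0n l) lt_ln.
have ex (i : 'I_l.+1) : exists z, c z = i.
  by have : i \in c @: setT by [rewrite (eqP surjc) inE]; case/imsetP=> z _ ->; exists z.
have [x cx] := ex ord0; have [y cy] := ex ord_max.
have [|A [rA _ _]] := @surj_rainbow c x y surjc; last by exists A.
by rewrite cx cy -val_eqE /=; lia.
Qed.

(** Points with different colors under [c] lie in a common rainbow set; equality of the flats makes
    it rainbow for [c'] too, so [c'] separates them. *)
Lemma color_flat_ker c c' : surjb c -> color_flat c = color_flat c' ->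
  forall x y, c' x = c' y -> c x = c y.
Proof.
move=> surjc eqF x y exy; apply/eqP; apply/negPn/negP => necxy.
have [A [rA xA yA]] := surj_rainbow surjc necxy.
have /andP[/eqP cA _] := rA; have [H HA] := cut_ground cA.
have := mem_color_flat c cA HA; rewrite eqF (mem_color_flat c' cA HA) rA => /negbFE.
move/(rainbowP _ cA)/(_ x y xA yA exy) => e.
by rewrite e eqxx in necxy.
Qed.

Definition color_flats : {set {set ground}} := [set color_flat c | c in [set c | surjb c]].

Lemma card_color_flats_ge :
  (#|[set c | surjb c]| <= #|color_flats| * (l.+1)`!)%N.
Proof.
rewrite -sum1_card (partition_big_imset color_flat) /= -/color_flats -sum_nat_const.
apply: leq_sum => F /imsetP[c]; rewrite inE => surjc ->.
have ex (i : 'I_l.+1) : exists z, c z = i.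
  by have : i \in c @: setT by [rewrite (eqP surjc) inE]; case/imsetP=> z _ ->; exists z.
have /fin_all_exists[r Hr] := ex.
rewrite sum1_card; set S := (X in (#|X| <= _)%N).
have SP c' : c' \in S -> surjb c' /\ forall x y, c x = c y <-> c' x = c' y.
  rewrite unfold_in /= inE => /andP[surjc' /eqP e]; split=> // x y.
  by split; apply: color_flat_ker.
(* The recoloring that takes [c] to [c'], read off on representatives [r] of the color classes. *)
pose g c' : {ffun 'I_l.+1 -> 'I_l.+1} := [ffun i => c' (r i)].
rewrite -(@card_in_imset _ _ g) => [|c1 c2 /SP[_ k1] /SP[_ k2] /ffunP e].
  have := card_inj_ffuns 'I_l.+1 'I_l.+1; rewrite !card_ord ffactnn => <-.
  apply/subset_leq_card/subsetP=> _ /imsetP[c' /SP[_ k'] ->].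
  rewrite inE; apply/injectiveP=> i j; rewrite !ffunE => /k'.
  by rewrite !Hr.
apply/ffunP=> x; have := e (c x); rewrite !ffunE.
by rewrite (proj1 (k1 (r (c x)) x)) ?Hr // (proj1 (k2 (r (c x)) x)) ?Hr.
Qed.

Definition initial_count A m := #|[set a in A | (a <= m)%N]|.

Lemma initial_countS A (x : 'I_n) m : x = m.+1 :> nat ->
  initial_count A x = (initial_count A m + (x \in A))%N.
Proof.
move=> xm; rewrite /initial_count; have [xA|xA] := boolP (x \in A).
  rewrite (cardsD1 x) inE xA leqnn addnC; congr (_ + _)%N; apply: eq_card => a.
  by rewrite !inE -val_eqE /= xm; case: (a \in A); lia.
rewrite addn0; apply: eq_card => a; rewrite !inE.
case aA: (a \in A) => //=; have : a != x by apply: contraNneq xA => <-.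
by rewrite -val_eqE /= xm; lia.
Qed.

Lemma initial_count_last A m : (n <= m.+1)%N -> initial_count A m = #|A|.
Proof.
move=> le_nm; apply: eq_card => a; rewrite inE.
by have -> : (a <= m)%N by [have := ltn_ord a; lia]; rewrite andbT.
Qed.

Lemma initial_count0 A (x : 'I_n) : x = 0%N :> nat -> initial_count A x = (x \in A).
Proof.
move=> x0; rewrite /initial_count.
have -> : [set a in A | (a <= x)%N] = A :&: [set x].
  by apply/setP=> a; rewrite !inE -val_eqE /= x0 leqn0.
have [xA|xA] := boolP (x \in A); first by rewrite (setIidPr _) ?sub1set // cards1.
by apply/eqP; rewrite cards_eq0 setI_eq0 disjoint_sym disjoints1.
Qed.

(* Colors the cyclic intervals into which the points of [A] cut ['I_n]. *)
Definition cyclic_coloring A : {ffun 'I_n -> 'I_l.+1} :=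
  [ffun x : 'I_n => inord (initial_count A x %% l.+1)].

Lemma cyclic_coloringE A x : cyclic_coloring A x = (initial_count A x %% l.+1)%N :> nat.
Proof. by rewrite ffunE inordK // ltn_pmod. Qed.

(** [y] is the cyclic predecessor of [x]: the color changes between them exactly when [x] is in [A].
    At [x = 0] the predecessor has count [l.+1], which is 0 modulo [l.+1]. As [y] does not depend on
    [A], the kernel of the coloring determines [A]. *)
Lemma cyclic_coloring_cut (x : 'I_n) : exists y : 'I_n, forall A, #|A| = l.+1 ->
  (x \in A) = (cyclic_coloring A x != cyclic_coloring A y).
Proof.
have mod1 : (1 %% l.+1 == 0)%N = false by rewrite modn_small //; lia.
have [x0|x_gt0] := posnP x.
  have lt_n1 : (n.-1 < n)%N by lia.
  exists (Ordinal lt_n1) => A cA; rewrite -val_eqE /= !cyclic_coloringE initial_count0 //.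
  rewrite initial_count_last /= ?cA ?modnn; last by lia.
  by case: (x \in A); rewrite ?mod1 ?mod0n.
have lt_x1 : (x.-1 < n)%N by have := ltn_ord x; lia.
exists (Ordinal lt_x1) => A cA; rewrite -val_eqE /= !cyclic_coloringE.
rewrite (@initial_countS A x x.-1) ?prednK //= -{2}[initial_count A x.-1]addn0.
by rewrite eqn_modDl mod0n; case: (x \in A); rewrite ?mod1 ?mod0n.
Qed.

(** The initial count rises by steps of at most 1 up to [l.+1], so it takes every value from 1
    on. *)
Lemma cyclic_coloring_surj A : #|A| = l.+1 -> surjb (cyclic_coloring A).
Proof.
move=> cA; have hit j : (0 < j)%N -> (j <= l.+1)%N -> exists x : 'I_n, initial_count A x = j.
  move=> j_gt0 le_jl; have ex : exists m, (j <= initial_count A m)%N.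
    by exists n.-1; rewrite initial_count_last ?cA //; lia.
  case: (ex_minnP ex) => m le_jm minm.
  have lt_mn : (m < n)%N.
    by have := minm n.-1; rewrite initial_count_last ?cA; [move=> /(_ le_jl); lia|lia].
  exists (Ordinal lt_mn); apply/eqP; rewrite eqn_leq le_jm andbT.
  have [m0|m_gt0] := posnP m.
    by rewrite (@initial_count0 A (Ordinal lt_mn)) //; case: (_ \in _); lia.
  rewrite (@initial_countS A (Ordinal lt_mn) m.-1) /= ?prednK //.
  have : (initial_count A m.-1 < j)%N.
    by rewrite ltnNge; apply/negP => /minm; lia.
  by case: (_ \in _); lia.
rewrite /surjb eqEsubset subsetT /=; apply/subsetP=> i _.
have [i0|i_gt0] := posnP i.
  have [x Nx] := hit l.+1 isT (leqnn _); apply/imsetP; exists x => //.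
  by apply: val_inj; rewrite /= cyclic_coloringE Nx modnn.
have [x Nx] := hit i i_gt0 (ltnW (ltn_ord i)); apply/imsetP; exists x => //.
by apply: val_inj; rewrite /= cyclic_coloringE Nx modn_small.
Qed.

(** Keeps the difference of coatoms and atoms nonnegative, so that the truncated subtraction in
    [coef1_bound] still gives a lower bound. *)
Lemma bin_color_flats : ('C(n, l.+1) <= #|color_flats|)%N.
Proof.
rewrite -[in 'C(n, _)](card_ord n) -card_draws.
rewrite -(@card_in_imset _ _ (fun A => color_flat (cyclic_coloring A))) => [|A B].
  apply/subset_leq_card/subsetP=> F /imsetP[A]; rewrite inE => /eqP cA ->.
  by apply/imsetP; exists (cyclic_coloring A); rewrite // inE cyclic_coloring_surj.
rewrite !inE => /eqP cA /eqP cB eqF; apply/setP=> x.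
have [y cut] := cyclic_coloring_cut x; rewrite (cut A) // (cut B) //; congr (~~ _).
by apply/eqP/eqP; apply: color_flat_ker; rewrite // cyclic_coloring_surj.
Qed.

Lemma color_flats_bound :
  #|color_flats|%:Z - ('C(n, l.+1))%:Z <= (arr_KL_poly arr)`_1.
Proof.
have := KL_poly_coef1 (@arr_rank_mono _ _ arr) (arr_rank0 arr) (@arr_rank_submod _ _ arr).
apply: le_trans; rewrite lerB ?lez_nat ?card_ground //.
apply/subset_leq_card/subsetP=> F /imsetP[c]; rewrite !inE => surjc ->.
by have [A rA] := surj_has_rainbow surjc; apply: color_flat_coatom rA.
Qed.

End HookArrangement.

(** * The explicit lower bound and its estimates *)

Section FirstCoefficient.

Variables (K : numFieldType) (l : nat).

(** The quotient is the Stirling number S(n, l+1). *)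
Definition coef1_bound n : nat :=
  (#|[set c : {ffun 'I_n -> 'I_l.+1} | surjb c]| %/ (l.+1)`! - 'C(n, l.+1))%N.

Lemma coef1_bound_le n : (0 < l)%N ->
  (coef1_bound n)%:Z <= (arr_KL_poly (hook_arr K l n))`_1.
Proof.
move=> l_gt0; rewrite /hook_arr; case: ltnP => [lt_ln|le_nl].
  apply: le_trans (color_flats_bound K l_gt0 lt_ln).
  have leF := bin_color_flats K l_gt0 lt_ln.
  have /(leq_div2r (l.+1)`!) := card_color_flats_ge K l_gt0 lt_ln.
  by rewrite mulnK ?fact_gt0 // /coef1_bound => leS; lia.
(* For [n <= l] there are no surjections and the bound is 0; the arrangement has no hyperplanes to
   subtract. *)
rewrite /coef1_bound (_ : [set c | surjb c] = set0) ?cards0 ?div0n ?sub0n; last first.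
  apply/setP=> c; rewrite !inE; apply/negP => /eqP surjc.
  have := leq_imset_card c setT; rewrite surjc !cardsT !card_ord; lia.
set arr := Arrangement _ _.
have := KL_poly_coef1 (@arr_rank_mono _ _ arr) (arr_rank0 arr) (@arr_rank_submod _ _ arr).
apply: le_trans; have -> : #|arr_ground arr| = 0%N by rewrite card_seq_sub.
by rewrite subr0.
Qed.

(** Union bound: a coloring that is not surjective misses one of the [l.+1] colors. *)
Lemma card_surj_ge n :
  (l.+1 ^ n <= #|[set c : {ffun 'I_n -> 'I_l.+1} | surjb c]| + l.+1 * l ^ n)%N.
Proof.
pose S := [set c : {ffun 'I_n -> 'I_l.+1} | surjb c].
have -> : (l.+1 ^ n = #|{ffun 'I_n -> 'I_l.+1}|)%N by rewrite card_ffun !card_ord.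
rewrite -(cardsC S) leq_add2l.
pose N i := [set c : {ffun 'I_n -> 'I_l.+1} | c \in ffun_on (predC1 i)].
have cN i : #|N i| = (l ^ n)%N.
  by rewrite cardsE card_ffun_on cardC1 !card_ord.
apply: (@leq_trans #|\bigcup_i N i|).
  apply/subset_leq_card/subsetP=> c; rewrite !inE /surjb eqEsubset subsetT /=.
  case/subsetPn=> i _ nci; apply/bigcupP; exists i => //; rewrite inE.
  by apply/ffun_onP=> x; rewrite inE; apply: contraNneq nci => <-; apply: imset_f.
apply: leq_trans (_ : \sum_i #|N i| <= _)%N.
  elim/big_rec2: _ => [|i m B _ le_mB]; first by rewrite cards0.
  by rewrite (leq_trans (leq_card_setU _ _)) // leq_add2l.
by rewrite (eq_bigr _ (fun i _ => cN i)) sum_nat_const card_ord.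
Qed.

Lemma card_surj_le n :
  (#|[set c : {ffun 'I_n -> 'I_l.+1} | surjb c]| <= l.+1 ^ n)%N.
Proof.
have -> : (l.+1 ^ n = #|{ffun 'I_n -> 'I_l.+1}|)%N by rewrite card_ffun !card_ord.
exact: max_card.
Qed.

(** Up to a constant factor the binomial is at most (3/2)^n, as one term of the expansion of (2 +
    1)^n; this is negligible against k^n for every k at least 2. *)
Lemma bin_pow_le n m : ('C(n, m) * 2 ^ n <= 2 ^ m * 3 ^ n)%N.
Proof.
have [lt_nm|le_mn] := ltnP n m; first by rewrite bin_small.
have : ('C(n, m) * 2 ^ (n - m) <= 3 ^ n)%N.
  rewrite -[3%N]/(2 + 1)%N expnDn (bigD1 (Ordinal (le_mn : (m < n.+1)%N))) //=.
  by rewrite exp1n muln1 leq_addr.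
have -> : (2 ^ n = 2 ^ m * 2 ^ (n - m))%N by rewrite -expnD subnKC.
rewrite mulnCA => le; exact: leq_mul.
Qed.

End FirstCoefficient.

Lemma coef1_bound_upper l n : (coef1_bound l n * (l.+1)`! <= l.+1 ^ n)%N.
Proof.
apply: leq_trans (card_surj_le l n); rewrite /coef1_bound mulnBl.
exact: leq_trans (leq_subr _ _) (leq_divM _ _).
Qed.

(** The three error terms account for non-surjective colorings, the remainder of the division and
    the atoms. *)
Lemma coef1_bound_lower l n :
  (l.+1 ^ n <= coef1_bound l n * (l.+1)`!
     + (l.+1 * l ^ n + (l.+1)`! + (l.+1)`! * 'C(n, l.+1)))%N.
Proof.
apply: leq_trans (card_surj_ge l n) _; rewrite /coef1_bound mulnBl.
set S := #|_|; rewrite {1}(divn_eq S (l.+1)`!).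
have := ltn_pmod S (fact_gt0 l.+1); rewrite [('C(n, _) * _)%N]mulnC; lia.
Qed.

(* The limit, by squeezing *)
From mathcomp Require Import complex.
From mathcomp Require Import all_classical all_reals all_analysis.

Import numFieldNormedType.Exports.
Local Open Scope classical_set_scope.
Local Open Scope ring_scope.

Lemma cvg_ratio_pow (R : realType) (k l N : nat) (f : nat -> nat) :
  (1 < k)%N -> (l < k)%N ->
  (forall n, (f n * N <= k ^ n)%N) ->
  (forall n, (k ^ n <= f n * N + (k * l ^ n + N + N * 'C(n, k)))%N) ->
  (fun n : nat => (f n)%:R * N%:R / k%:R ^+ n : R) @ \oo --> (1 : R).
Proof.
move=> k_gt1 lt_lk ub lb.
have k2 : 2 <= k%:R :> R by rewrite ler_nat.
have k_gt0 : 0 < k%:R :> R by lra.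
(* The error terms divided by [k ^ n] are bounded by geometric sequences of ratios l/k, 1/k and
   3/(2k), all below 1 because [l < k] and [2 <= k]. *)
pose lo n : R := 1 - (k%:R * (l%:R / k%:R) ^+ n + N%:R * (k%:R^-1) ^+ n + N%:R * 2 ^+ k * (3 / (2 * k%:R)) ^+ n).
apply: (@squeeze_cvgr _ _ _ _ lo (fun=> 1)).
- apply: nearW => n; have kn_gt0 : 0 < k%:R ^+ n :> R by rewrite exprn_gt0.
  apply/andP; split; last first.
    by rewrite ler_pdivrMr // mul1r -natrM -natrX ler_nat.
  rewrite ler_pdivlMr // /lo mulrBl mul1r lerBlDr.
  have := lb n; rewrite -(ler_nat R) !natrD !natrM !natrX.
  move=> /le_trans; apply; rewrite lerD2l 2!(mulrDl _ _ (k%:R ^+ n)).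
  rewrite -!mulrA -!exprMn divfK ?gt_eqF // mulVf ?gt_eqF // expr1n mulr1 lerD2l.
  rewrite ler_wpM2l ?ler0n //.
  have -> : 3 / (2 * k%:R) * k%:R = 3 / 2 :> R by field; rewrite gt_eqF.
  rewrite expr_div_n mulrA ler_pdivlMr ?exprn_gt0 //.
  by have := bin_pow_le n k; rewrite -(ler_nat R) !natrM !natrX.
- have geo a z : 0 <= z -> z < 1 -> (fun n => a * z ^+ n : R) @ \oo --> (0 : R).
    by move=> z_ge0 z_lt1; apply: cvg_geometric; rewrite ger0_norm.
  rewrite -[X in _ --> X]subr0 -[X in _ - X]addr0 -[X in _ - (X + _)]addr0.
  apply: cvgB; first exact: cvg_cst.
  apply: cvgD; first apply: cvgD; apply: geo.
  - by rewrite divr_ge0 ?ler0n.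
  - by rewrite ltr_pdivrMr // mul1r ltr_nat.
  - by rewrite invr_ge0 ler0n.
  - by rewrite invf_lt1 //; lra.
  - by rewrite divr_ge0 //; lra.
  - by rewrite ltr_pdivrMr //; lra.
- exact: cvg_cst.
Qed.

Theorem theorem1p5 (R : realType) (l : nat) (hl : (0 < l)%N) :
  exists f : nat -> nat,
    (forall n : nat, (f n)%:Z <= (arr_KL_poly (hook_arr R[i] l n))`_1) /\
    ((fun n : nat => (f n)%:R * (l.+1)`!%:R / (l.+1)%:R ^+ n : R) @ \oo
       --> (1 : R)).
Proof.
exists (coef1_bound l); split=> [n|]; first exact: coef1_bound_le.
apply: (@cvg_ratio_pow R l.+1 l) => // n; [exact: coef1_bound_upper|exact: coef1_bound_lower].
Qed.
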